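(* There is a Jordan loop $\gamma$ in the plane with curvature strictly between $-1$ and $1$ such that the interior region $R$ of $\gamma$ is neither drawable nor closed-disk drawable. However, $R$ is locally drawable and locally closed-disk drawable.
   Context: For $A\subseteq\mathbb{R}^2$ let $N(A)=\{x\in\mathbb{R}^2: |x-a|<1 \text{ for some } a\in A\}$ and $N_{\le}(A)=\{x\in\mathbb{R}^2: |x-a|\le 1 \text{ for some } a\in A\}$. Let $\mathcal{D}_1=\{N(A_1): A_1\subseteq\mathbb{R}^2\}$ and for $n\ge 2$ let $\mathcal{D}_n=\{D\cup N(A_n): D\in\mathcal{D}_{n-1}, A_n\subseteq\mathbb{R}^2\}$ if $n$ is odd and $\mathcal{D}_n=\{D\setminus N(A_n): D\in\mathcal{D}_{n-1}, A_n\subseteq\mathbb{R}^2\}$ if $n$ is even. A set is drawable if it lies in $\mathcal{D}=\bigcup_{n\ge1}\mathcal{D}_n$. The collection $\mathcal{D}_{\le}$ of closed-disk drawable sets is defined in the same way with every $N(\cdot)$ replaced by $N_{\le}(\cdot)$. A set $B\subseteq\mathbb{R}^2$ is locally drawable if every point $x\in\mathbb{R}^2$ has a neighborhood $U$ such that there is $D\in\mathcal{D}$ with $U\cap B=U\cap D$; locally closed-disk drawable is defined analogously with $D\in\mathcal{D}_{\le}$. *)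

(* Defs.v *)
From HB Require Import structures.
From mathcomp Require Import all_boot all_order all_algebra.
From mathcomp Require Import all_classical all_reals all_analysis.
Set Implicit Arguments. Unset Strict Implicit. Unset Printing Implicit Defensive.
Import Order.TTheory GRing.Theory Num.Theory.
Import numFieldNormedType.Exports.
Local Open Scope classical_set_scope.
Local Open Scope ring_scope.

Section Drawing.
Variable R : realType.
Local Notation P := (R * R)%type.

Definition edist (p q : P) : R :=
  Num.sqrt ((p.1 - q.1) ^+ 2 + (p.2 - q.2) ^+ 2).

Definition Nopen (A : set P) : set P := [set x | exists2 a, A a & edist x a < 1].
Definition Nclosed (A : set P) : set P := [set x | exists2 a, A a & edist x a <= 1].

(* drawn_sets Nb n = D_n (for n >= 1; D_0 is empty), built from the
   neighbourhood operator Nb *)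
Fixpoint drawn_sets (Nb : set P -> set P) (n : nat) : set (set P) :=
  match n with
  | 0 => set0
  | m.+1 =>
    match m with
    | 0 => [set Nb A | A in [set: set P]]
    | _ => if odd n
           then [set D `|` Nb A | D in drawn_sets Nb m & A in [set: set P]]
           else [set D `\` Nb A | D in drawn_sets Nb m & A in [set: set P]]
    end
  end.

Definition drawable (B : set P) : Prop := exists n, drawn_sets Nopen n B.
Definition cdrawable (B : set P) : Prop := exists n, drawn_sets Nclosed n B.

Definition locally_drawable_with (dr : set P -> Prop) (B : set P) : Prop :=
  forall x : P, exists U : set P, nbhs x U /\ exists D, dr D /\ U `&` B = U `&` D.

Definition locally_drawable := locally_drawable_with drawable.
Definition locally_cdrawable := locally_drawable_with cdrawable.

Definition bounded_plane (S : set P) : Prop :=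
  exists M : R, forall q, S q -> edist (0, 0) q <= M.

Definition C2_regular_jordan_loop (x y : R -> R) (L : R) : Prop :=
  [/\ 0 < L /\ (forall t, x (t + L) = x t /\ y (t + L) = y t),
      (forall s t, 0 <= s < L -> 0 <= t < L -> (x s, y s) = (x t, y t) -> s = t),
      (forall t, [/\ derivable x t 1, derivable y t 1,
                     derivable (derive1 x) t 1 & derivable (derive1 y) t 1]),
      (continuous (derive1 (derive1 x)) /\ continuous (derive1 (derive1 y))) &
      (forall t, (derive1 x t) ^+ 2 + (derive1 y t) ^+ 2 != 0)].

Definition curvature (x y : R -> R) (t : R) : R :=
  (derive1 x t * derive1 (derive1 y) t - derive1 y t * derive1 (derive1 x) t)
    / (Num.sqrt ((derive1 x t) ^+ 2 + (derive1 y t) ^+ 2)) ^+ 3.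

Definition curve_image (x y : R -> R) : set P := [set (x t, y t) | t in [set: R]].

Definition interior_region (x y : R -> R) : set P :=
  [set p | ~ curve_image x y p /\
           bounded_plane (connected_component (~` curve_image x y) p)].

End Drawing.

(* Main.v *)
Require Import Defs.
From mathcomp Require Import all_boot all_order all_algebra.
From mathcomp Require Import all_classical all_reals all_analysis.
From mathcomp Require Import ring lra.
Import Order.TTheory GRing.Theory Num.Theory numFieldNormedType.Exports.
Import Defs.
Set Implicit Arguments.
Unset Strict Implicit.
Unset Printing Implicit Defensive.
Local Open Scope classical_set_scope.
Local Open Scope ring_scope.

(* The curve is a meander winding around a large circle, in polar coordinates
     r = 9m/20 + 4 cos t,  m theta = t + 2 sin 2t   (0 <= t < 2 pi m, m = 1000).
   For cos t = 0 consecutive strands run nearly parallel at distance less than 2, so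
   each of the two unit disks tangent to a strand contains a point of a neighbouring
   strand in its interior.  Hence, if G is the part of the curve with cos t small, every
   closed unit disk meeting a small neighbourhood S of G contains a point of G in its
   interior, so it meets both the interior and the exterior region inside S.  The last
   stroke of the brush that touches S then spoils a drawing of the interior region.

   Locally, curvature less than 1 lets a unit disk touch the curve from either side
   without crossing it.  The complement of the curve is split by the sign of a continuous
   function of the plane vanishing exactly on the curve, so the intermediate value theorem
   on segments replaces orientation and Jordan separation arguments. *)

(** The shape of the meander settles a conflict. Crowding wants neighbouring strands less than 2
    apart, but a plain U-turn joining parallel strands at such a distance would have curvature above
    1 somewhere. The term 2 sin 2t lets each bend bulge like an omega: the phase t + 2 sin 2t has
    derivative 5 at the turns (cos t = 1 or -1) and -3 at the necks (cos t = 0). With the factor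
    9/20 the necks are about 9 pi / 20, roughly 1.41, wide, while the curvature at a turn is about 4
    / (9/4)^2 = 64/81. These values belong to a meander along a straight strip. Winding the strip
    around a circle closes it into a loop at the price of errors of order 1/m; m = 1000 makes them
    so small that rough rational estimates, including 3 < pi < 4, are enough. Since the phase is odd
    and commutes with shifts by 2 pi, its cosine depends on cos t only, that is, on the radius.
    Hence the curve has an equation cos (m theta) = function of r, from which the sign function is
    built. *)

Section ContinuousArithmetic.
Variables (R : realType) (T : topologicalType).
Implicit Types f g : T -> R.

Lemma contD f g : continuous f -> continuous g -> continuous (fun t => f t + g t).
Proof. by move=> cf cg t; apply: cvgD; [exact: cf|exact: cg]. Qed.

Lemma contB f g : continuous f -> continuous g -> continuous (fun t => f t - g t).
Proof. by move=> cf cg t; apply: cvgB; [exact: cf|exact: cg]. Qed.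

Lemma contM f g : continuous f -> continuous g -> continuous (fun t => f t * g t).
Proof. by move=> cf cg t; apply: cvgM; [exact: cf|exact: cg]. Qed.

Lemma contX f n : continuous f -> continuous (fun t => f t ^+ n).
Proof.
move=> cf; elim: n => [|n IHn]; first by move=> t; exact: cvg_cst.
have -> : (fun t => f t ^+ n.+1) = (fun t => f t * f t ^+ n).
  by apply/funext => t; rewrite exprS.
exact: contM.
Qed.

Lemma cont_cst (c : R) : continuous (fun _ : T => c).
Proof. by move=> t; exact: cvg_cst. Qed.

Lemma cont_comp f (h : R -> R) : continuous h -> continuous f ->
  continuous (fun t => h (f t)).
Proof. by move=> ch cf t; apply: continuous_comp; [exact: cf|exact: ch]. Qed.

Lemma cont_pair f g : continuous f -> continuous g -> continuous (fun t => (f t, g t)).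
Proof. by move=> cf cg t; apply: (cvg_pair (cf t) (cg t)). Qed.

End ContinuousArithmetic.

(** * Euclidean distance, disks and segments in the plane *)

Section Plane.
Variable R : realType.
Local Notation P := (R * R)%type.
Implicit Types (p q a z : P) (r e : R).

Definition sqd p q : R := (p.1 - q.1) ^+ 2 + (p.2 - q.2) ^+ 2.

Lemma sqd_ge0 p q : 0 <= sqd p q.
Proof. by rewrite addr_ge0 ?sqr_ge0. Qed.

Lemma sqdC p q : sqd p q = sqd q p.
Proof. by rewrite /sqd; ring. Qed.

Lemma edistC p q : edist p q = edist q p.
Proof. by rewrite /edist -/(sqd p q) sqdC. Qed.

Lemma edist_ge0 p q : 0 <= edist p q.
Proof. exact: sqrtr_ge0. Qed.

Lemma edist_sqr p q : edist p q ^+ 2 = sqd p q.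
Proof. by rewrite sqr_sqrtr // sqd_ge0. Qed.

Lemma edist_lt p q r : 0 < r -> (edist p q < r) = (sqd p q < r ^+ 2).
Proof. by move=> r0; rewrite -edist_sqr ltr_sqr ?nnegrE ?edist_ge0 ?ltW. Qed.

Lemma edist_le p q r : 0 <= r -> (edist p q <= r) = (sqd p q <= r ^+ 2).
Proof. by move=> r0; rewrite -edist_sqr ler_sqr ?nnegrE ?edist_ge0. Qed.

Lemma edist_lt1 p q : (edist p q < 1) = (sqd p q < 1).
Proof. by rewrite edist_lt // expr1n. Qed.

Lemma edist_le1 p q : (edist p q <= 1) = (sqd p q <= 1).
Proof. by rewrite edist_le // expr1n. Qed.

Lemma edistxx p : edist p p = 0.
Proof. by rewrite /edist !subrr expr0n addr0 sqrtr0. Qed.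

Lemma edist0_eq p q : edist p q = 0 -> p = q.
Proof.
move=> h; have := edist_sqr p q; rewrite h expr0n /= => /esym/eqP.
rewrite paddr_eq0 ?sqr_ge0 // !sqrf_eq0 !subr_eq0.
by case: p q {h} => [p1 p2] [q1 q2] /= /andP[/eqP -> /eqP ->].
Qed.

Lemma norm_lt_sqr (x r : R) : 0 < r -> (`|x| < r) = (x ^+ 2 < r ^+ 2).
Proof.
by move=> r0; rewrite -[x ^+ 2]real_normK ?num_real // ltr_sqr ?nnegrE // ltW.
Qed.

Lemma norm_le_sqr (x r : R) : 0 <= r -> (`|x| <= r) = (x ^+ 2 <= r ^+ 2).
Proof.
by move=> r0; rewrite -[x ^+ 2]real_normK ?num_real // ler_sqr ?nnegrE.
Qed.

Lemma edist_triangle q p a : edist p a <= edist p q + edist q a.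
Proof.
have h0 := edist_ge0 p q; have h1 := edist_ge0 q a.
rewrite edist_le ?addr_ge0 //.
set u1 := p.1 - q.1; set u2 := p.2 - q.2.
set v1 := q.1 - a.1; set v2 := q.2 - a.2.
have -> : sqd p a = sqd p q + sqd q a + 2 * (u1 * v1 + u2 * v2).
  by rewrite /sqd /u1 /u2 /v1 /v2; ring.
rewrite sqrrD !edist_sqr.
suff : u1 * v1 + u2 * v2 <= edist p q * edist q a by lra.
apply: le_trans (ler_norm _) _.
rewrite norm_le_sqr ?mulr_ge0 // exprMn !edist_sqr.
rewrite /sqd -/u1 -/u2 -/v1 -/v2.
(* Cauchy-Schwarz through Lagrange's identity: the defect is the square of the determinant. *)
rewrite -subr_ge0 [X in 0 <= X](_ : _ = (u1 * v2 - u2 * v1) ^+ 2) ?sqr_ge0 //.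
by ring.
Qed.

(** The balls of the product topology are squares: the disk of radius [e] lies in the square of
    half-width [e] and contains the one of half-width [e / 2]. *)
Lemma nbhs_edist p (U : set P) :
  nbhs p U <-> exists2 e, 0 < e & forall q, edist q p < e -> U q.
Proof.
split.
  move=> /nbhs_ballP[e /= e0 eU]; exists e => // q qp; apply: eU.
  move: qp; rewrite edist_lt // => h.
  split; rewrite /ball /= norm_lt_sqr //.
    by apply: le_lt_trans h; rewrite /sqd -sqrrN opprB lerDl sqr_ge0.
  by apply: le_lt_trans h; rewrite /sqd -sqrrN opprB lerDr sqr_ge0.
move=> [e e0 eU]; apply/nbhs_ballP; exists (e / 2); first by rewrite /= divr_gt0.
move=> q [/= h1 h2]; apply: eU; rewrite edist_lt //.
move: h1 h2; rewrite /ball /= => /ltW h1 /ltW h2.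
have e20 : 0 <= e / 2 by rewrite divr_ge0 // ltW.
move: h1 h2; rewrite !norm_le_sqr // => h1 h2.
rewrite /sqd -(sqrrN (q.1 - _)) -(sqrrN (q.2 - _)) !opprB.
have : 0 < e ^+ 2 by rewrite exprn_gt0.
rewrite exprMn in h1 h2; move: h1 h2; rewrite expr2; lra.
Qed.

Lemma open_edist (U : set P) :
  (forall p, U p -> exists2 e, 0 < e & forall q, edist q p < e -> U q) -> open U.
Proof. by move=> h; rewrite openE => p /h /nbhs_edist. Qed.

Lemma continuous_edist_lt (f : P -> R) p e : {for p, continuous f} -> 0 < e ->
  exists2 d, 0 < d & forall q, edist q p < d -> `|f q - f p| < e.
Proof.
move=> fp e0; apply/nbhs_edist.
have /cvgrPdist_lt/(_ e e0) := fp.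
by apply: filterS => q; rewrite distrC.
Qed.

Lemma continuous_sqd p : continuous (fun q => sqd q p).
Proof.
have c1 : continuous (fun q : P => q.1) by move=> q; exact: cvg_fst.
have c2 : continuous (fun q : P => q.2) by move=> q; exact: cvg_snd.
by apply: contD; apply: contX; apply: contB => //; exact: cont_cst.
Qed.

Lemma continuous_edist p : continuous (fun q => edist q p).
Proof.
move=> q; apply: (@continuous_comp _ _ _ (fun q => sqd q p) (@Num.sqrt R)).
  exact: continuous_sqd.
exact: sqrt_continuous.
Qed.

Lemma edist_box p q r : edist q p <= r -> `|q.1 - p.1| <= r /\ `|q.2 - p.2| <= r.
Proof.
move=> h; have r0 : 0 <= r := le_trans (edist_ge0 _ _) h.
move: h; rewrite edist_le // => h.
split; rewrite norm_le_sqr //; apply: le_trans h.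
  by rewrite lerDl sqr_ge0.
by rewrite lerDr sqr_ge0.
Qed.

Lemma compact_closed_disk (K : set P) p r :
  closed K -> compact (K `&` [set q | edist q p <= r]).
Proof.
move=> cK.
apply: (@subclosed_compact _ _
  (`[p.1 - r, p.1 + r] `*` `[p.2 - r, p.2 + r])); last first.
- move=> q [_ /= /edist_box[]]; rewrite !ler_distl => h1 h2.
  by split; rewrite /= in_itv.
- by apply: compact_setX; exact: segment_compact.
apply: closedI => //.
have -> : [set q | edist q p <= r] = (fun q => edist q p) @^-1` [set x | x <= r].
  by [].
by apply: closed_comp; [move=> q _; exact: continuous_edist|exact: closed_le].
Qed.

(** The distance from [p] attains its minimum on the compact part of [K] within [r + 1], and that
    minimum is below every [r + e]. *)
Lemma closed_near (K : set P) p r : closed K ->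
  (forall e, 0 < e -> exists2 a, K a & edist a p < r + e) ->
  exists2 a, K a & edist a p <= r.
Proof.
move=> cK near.
have [a0 Ka0 a0p] := near 1 ltr01.
have [||a + amin] := @compact_EVT_min _ _ (fun q => edist q p) _ _
    (@compact_closed_disk K p (r + 1) cK).
- by exists a0; split => //; exact: ltW.
- by apply: continuous_subspaceT => q; exact: continuous_edist.
rewrite inE => -[Ka _]; exists a => //.
apply/ler_addgt0Pr => e e0.
(* The cap at 1 keeps the approximating point inside the compact part on which [a] is minimal. *)
have e10 : 0 < Num.min e 1 by rewrite lt_min e0 ltr01.
have [b Kb bp] := near _ e10.
apply: (@le_trans _ _ (edist b p)); last first.
  by apply: (le_trans (ltW bp)); rewrite lerD2l ge_min lexx.
apply: amin; rewrite inE; split => //=.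
by apply: (le_trans (ltW bp)); rewrite lerD2l ge_min lexx orbT.
Qed.

Definition lerp p z (s : R) : P := (p.1 + s * (z.1 - p.1), p.2 + s * (z.2 - p.2)).

(** Stewart's identity: the two sides differ by exactly [s * (1 - s) * sqd p z]. This is the
    convexity of disks. *)
Lemma sqd_lerp p z a s : 0 <= s <= 1 ->
  sqd (lerp p z s) a <= (1 - s) * sqd p a + s * sqd z a.
Proof.
move=> /andP[s0 s1].
have -> : (1 - s) * sqd p a + s * sqd z a =
    sqd (lerp p z s) a + s * (1 - s) * sqd p z by rewrite /sqd /lerp /=; ring.
by rewrite lerDl !mulr_ge0 ?sqd_ge0 ?subr_ge0.
Qed.

Lemma edist_lerp p z a r s : 0 <= s <= 1 ->
  edist p a < r -> edist z a < r -> edist (lerp p z s) a < r.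
Proof.
move=> s01 pr zr; have r0 : 0 < r := le_lt_trans (edist_ge0 _ _) pr.
move: pr zr; rewrite !edist_lt // => pr zr.
apply: le_lt_trans (sqd_lerp _ _ _ s01) _.
case/andP: s01 => s0 s1.
have [->|sn0] := eqVneq s 0; first by rewrite subr0 mul1r mul0r addr0.
have : s * sqd z a < s * r ^+ 2 by rewrite ltr_pM2l // lt_neqAle eq_sym sn0.
have : (1 - s) * sqd p a <= (1 - s) * r ^+ 2.
  by rewrite ler_wpM2l ?subr_ge0 // ltW.
lra.
Qed.

Lemma edist_lerpl p z s : 0 <= s -> edist (lerp p z s) p = s * edist z p.
Proof.
move=> s0; apply/eqP; rewrite -(eqrXn2 (n := 2)) ?mulr_ge0 ?edist_ge0 //.
by rewrite exprMn !edist_sqr /sqd /lerp /=; apply/eqP; ring.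
Qed.

Lemma continuous_lerp p z : continuous (lerp p z).
Proof.
apply: cont_pair; apply: contD; first exact: cont_cst.
  by apply: contM; [move=> s; exact: cvg_id|exact: cont_cst].
- exact: cont_cst.
- by apply: contM; [move=> s; exact: cvg_id|exact: cont_cst].
Qed.

End Plane.

(** * Obstructions to drawability *)

Section NotDrawable.
Variable R : realType.
Local Notation P := (R * R)%type.

(* Near S every stroke of the brush paints both points of B and points of its
   complement, so the last stroke that touches S destroys agreement with B. *)
Lemma mixed_not_drawn (K : P -> P -> Prop) (S B : set P) :
  (exists2 z, S z & B z) ->
  (forall z a, S z -> K z a -> (exists2 w, S w /\ B w & K w a) /\
                               (exists2 w, S w /\ ~ B w & K w a)) ->
  forall n D, drawn_sets (fun A => [set x | exists2 a, A a & K x a]) n D ->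
  ~ (forall z, S z -> B z <-> D z).
Proof.
move=> [z0 Sz0 Bz0] mixed; elim=> [//|[|n] IHn] D /=.
  move=> [A _ <-] BD; have [a Aa Ka] := (BD z0 Sz0).1 Bz0.
  have [_ [w [Sw nBw] Kw]] := mixed _ _ Sz0 Ka.
  by apply: nBw; apply/(BD w Sw); exists a.
case: ifP => _ [D' D'n [A _ <-]] BD.
- have noA z a : S z -> A a -> ~ K z a.
    move=> Sz Aa Ka; have [_ [w [Sw nBw] Kw]] := mixed _ _ Sz Ka.
    by apply: nBw; apply/(BD w Sw); right; exists a.
  apply: (IHn _ D'n) => z Sz; rewrite BD //; split; last by left.
  by move=> [//|[a Aa /(noA _ _ Sz Aa)]].
- have noA z a : S z -> A a -> ~ K z a.
    move=> Sz Aa Ka; have [[w [Sw Bw] Kw] _] := mixed _ _ Sz Ka.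
    by have [_] := (BD w Sw).1 Bw; apply; exists a.
  apply: (IHn _ D'n) => z Sz; rewrite BD //; split; first by case.
  by move=> D'z; split=> // -[a Aa /(noA _ _ Sz Aa)].
Qed.

(** Assuming contact with the closed disk and concluding contact with the open one handles both
    brushes at once. *)
Lemma mixed_not_drawable (S B : set P) :
  (exists2 z, S z & B z) ->
  (forall z a, S z -> edist z a <= 1 ->
     (exists2 w, S w /\ B w & edist w a < 1) /\
     (exists2 w, S w /\ ~ B w & edist w a < 1)) ->
  ~ drawable B /\ ~ cdrawable B.
Proof.
move=> SB mixed; split=> -[n].
  move=> /(@mixed_not_drawn (fun x a => edist x a < 1) _ _ SB); apply; last by [].
  by move=> z a Sz /ltW; exact: mixed.
move=> /(@mixed_not_drawn (fun x a => edist x a <= 1) _ _ SB); apply; last by [].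
move=> z a Sz /(mixed _ _ Sz) [[w Sw wa] [w' Sw' wa']].
by split; [exists w|exists w'] => //; exact: ltW.
Qed.

(* The mixing region is {z : every closed unit disk around z contains a point of
   G in its interior}; closed_near makes it a neighbourhood of G. *)
Lemma crowded_not_drawable (G B : set P) :
  G !=set0 ->
  (forall g a, G g -> edist a g <= 1 -> exists2 g', G g' & edist a g' < 1) ->
  (forall g e, G g -> 0 < e -> (exists2 w, edist w g < e & B w) /\
                               (exists2 w, edist w g < e & ~ B w)) ->
  ~ drawable B /\ ~ cdrawable B.
Proof.
move=> [g0 Gg0] crowd bdry.
pose S : set P := [set z | forall a, edist a z <= 1 -> exists2 g, G g & edist a g < 1].
have SG g : G g -> exists2 e, 0 < e & forall z, edist z g < e -> S z.
  move=> Gg; apply: contrapT => noe.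
  (* Centres whose open unit disk misses [G]. If no neighbourhood of [g] were inside [S], this
     closed set would come within [1 + e] of [g] for every [e], hence within 1, against [crowd]. *)
  pose K : set P := [set a | forall g', G g' -> 1 <= edist a g'].
  have cK : closed K.
    rewrite -openC; apply: open_edist => a /= /existsNP[g' /not_implyP[Gg']].
    move/negP; rewrite -ltNge => ag'.
    exists (1 - edist a g'); first by rewrite subr_gt0.
    move=> b ba /(_ g' Gg'); apply/negP; rewrite -ltNge.
    by apply: le_lt_trans (edist_triangle a _ _) _; rewrite -ltrBrDr.
  have [|a Ka ag] := @closed_near _ K g 1 cK; last first.
    by have [g' Gg' /lt_geF] := crowd _ _ Gg ag; rewrite Ka.
  move=> e e0; apply: contrapT => nK; apply: noe; exists e => // z zg a az.
  apply: contrapT => nag; apply: nK; exists a.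
    by move=> g' Gg'; rewrite leNgt; apply/negP => ag'; apply: nag; exists g'.
  by apply: le_lt_trans (edist_triangle z _ _) _; exact: ler_ltD.
apply: (@mixed_not_drawable S).
  have [e e0 eS] := SG _ Gg0.
  by have [[w wg Bw] _] := bdry _ _ Gg0 e0; exists w => //; exact: eS.
move=> z a Sz; rewrite edistC => /Sz[g Gg ag].
have [e e0 eS] := SG _ Gg.
(* The points sought near [g] must stay in [S] and also inside the open disk around [a]. *)
have d0 : 0 < Num.min e (1 - edist a g) by rewrite lt_min e0 subr_gt0.
have [[w wg Bw] [w' w'g Bw']] := bdry _ _ Gg d0.
move: wg w'g; rewrite !lt_min => /andP[we wa] /andP[w'e w'a].
split; [exists w|exists w'].
- by split => //; exact: eS.
- apply: le_lt_trans (edist_triangle g _ _) _.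
  by rewrite (edistC g); rewrite -ltrBrDr.
- by split => //; exact: eS.
- apply: le_lt_trans (edist_triangle g _ _) _.
  by rewrite (edistC g); rewrite -ltrBrDr.
Qed.

End NotDrawable.

(** * Curves of curvature less than one *)

Section RealCalculus.
Variable R : realType.
Implicit Types (f df : R -> R).

Lemma is_derive_continuous f df : (forall t, is_derive (t : R) 1 f (df t)) -> continuous f.
Proof.
by move=> fdf t; apply: differentiable_continuous; apply/derivable1_diffP; case: (fdf t).
Qed.

Lemma mean_value f df a b : (forall t, is_derive (t : R) 1 f (df t)) -> a < b ->
  exists2 c, a < c < b & f b - f a = df c * (b - a).
Proof.
move=> fdf ab.
have [//|c] := @MVT _ f df a b ab (fun t _ => fdf t).
  by apply: continuous_subspaceT; exact: is_derive_continuous fdf.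
by rewrite in_itv /=; exists c.
Qed.

(** By the mean value theorem for [df], the slope is at most 0 before [s] and at least 0 after it.
    The intended [f] is the squared distance from a disk centre to the curve. *)
Lemma convex_critical_min f df ddf t0 r s t :
  (forall c, is_derive (c : R) 1 f (df c)) -> (forall c, is_derive (c : R) 1 df (ddf c)) ->
  (forall c, `|c - t0| < r -> 0 <= ddf c) -> df s = 0 ->
  `|s - t0| < r -> `|t - t0| < r -> f s <= f t.
Proof.
move=> fdf dfddf ddf0 dfs sr tr.
have [st|ts|<-//] := ltgtP s t.
- have [c /andP[sc ct] E] := mean_value fdf st.
  have [c' /andP[sc' c'c] E'] := mean_value dfddf sc.
  have : 0 <= ddf c'.
    by apply: ddf0; move: sr tr; rewrite !ltr_distl => /andP[? ?] /andP[? ?]; lra.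
  move: E'; rewrite dfs subr0 => E'; rewrite E' in E => h.
  by rewrite -subr_ge0 E !mulr_ge0 //; lra.
- have [c /andP[sc ct] E] := mean_value fdf ts.
  have [c' /andP[sc' c'c] E'] := mean_value dfddf ct.
  have : 0 <= ddf c'.
    by apply: ddf0; move: sr tr; rewrite !ltr_distl => /andP[? ?] /andP[? ?]; lra.
  move: E'; rewrite dfs sub0r => E' h.
  have : df c <= 0 by rewrite -oppr_ge0 E' mulr_ge0 //; lra.
  move=> dc; rewrite -subr_le0 E mulr_le0_ge0 //; lra.
Qed.

(** Fermat's theorem on interior extrema, contraposed. *)
Lemma decrease_near f df (t e : R) : (forall t, is_derive (t : R) 1 f (df t)) ->
  df t != 0 -> 0 < e -> exists2 s, `|s - t| < e & f s < f t.
Proof.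
move=> fdf dn0 e0; apply: contrapT => nos.
have ft : is_derive (t : R) 1 f 0.
  apply: (@derive1_at_min _ f (t - e) (t + e)).
  - lra.
  - by move=> s _; case: (fdf s).
  - by rewrite in_itv /=; apply/andP; split; lra.
  - move=> s; rewrite in_itv /= -ltr_distl => se.
    by rewrite leNgt; apply/negP => fs; apply: nos; exists s.
case/negP: dn0; apply/eqP.
by rewrite -(@derive_val _ _ _ _ _ _ _ (fdf t)) (@derive_val _ _ _ _ _ _ _ ft).
Qed.

End RealCalculus.

(** * Unit disks on either side of a loop of curvature below one *)

Section LocallyDrawable.
Variable R : realType.
Local Notation P := (R * R)%type.

Lemma continuous_fst_comp (f : R -> R) : continuous f -> continuous (fun z : P => f z.1).
Proof. by move=> cf; apply: cont_comp => // z; exact: cvg_fst. Qed.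

Lemma continuous_snd_comp (f : R -> R) : continuous f -> continuous (fun z : P => f z.2).
Proof. by move=> cf; apply: cont_comp => // z; exact: cvg_snd. Qed.

Lemma positive_near_diag (f : P -> R) (t0 : R) : continuous f -> 0 < f (t0, t0) ->
  exists2 d : R, 0 < d & forall s t, `|s - t0| < d -> `|t - t0| < d -> 0 < f (s, t).
Proof.
move=> cf f0; have [d d0 fd] := continuous_edist_lt (cf (t0, t0)) f0.
exists (d / 2); first by rewrite divr_gt0.
move=> s t sd td; have : `|f (s, t) - f (t0, t0)| < f (t0, t0).
  apply: fd; rewrite edist_lt // /sqd /=.
  have d2 : 0 < d / 2 by rewrite divr_gt0.
  move: sd td; rewrite !norm_lt_sqr // !exprMn.
  have : 0 < d ^+ 2 by rewrite exprn_gt0.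
  by rewrite !expr2; lra.
by rewrite ltr_norml => /andP[]; lra.
Qed.

Variables (x y x1 y1 x2 y2 : R -> R) (L : R) (F : P -> R).
Hypothesis xD : forall t, is_derive (t : R) 1 x (x1 t).
Hypothesis yD : forall t, is_derive (t : R) 1 y (y1 t).
Hypothesis x1D : forall t, is_derive (t : R) 1 x1 (x2 t).
Hypothesis y1D : forall t, is_derive (t : R) 1 y1 (y2 t).
Hypothesis x2C : continuous x2.
Hypothesis y2C : continuous y2.
Hypothesis curv : forall t,
  (x1 t * y2 t - y1 t * x2 t) ^+ 2 < (x1 t ^+ 2 + y1 t ^+ 2) ^+ 3.
Hypothesis L0 : 0 < L.
Hypothesis xper : periodic x L.
Hypothesis yper : periodic y L.
Hypothesis inj : forall s t, `|s - t| < L -> x s = x t -> y s = y t -> s = t.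

Let g t : P := (x t, y t).
Let N t := x1 t ^+ 2 + y1 t ^+ 2.
Let xC := is_derive_continuous xD.
Let yC := is_derive_continuous yD.
Let x1C := is_derive_continuous x1D.
Let y1C := is_derive_continuous y1D.

Lemma periodic_int (f : R -> R) : periodic f L -> forall (k : int) t, f (t + L *~ k) = f t.
Proof.
move=> fL [n|n] t; first exact: periodicn.
by rewrite NegzE mulrNz -[LHS](periodicn fL n.+1) subrK.
Qed.

Lemma loop_reduce c t : exists2 t', c <= t' < c + L & g t' = g t.
Proof.
exists (t + L *~ (- Num.floor ((t - c) / L))); last by rewrite /g !periodic_int.
have := Num.Theory.floor_le ((t - c) / L); have := Num.Theory.lt_succ_floor ((t - c) / L).
set k := Num.floor _; rewrite intrD mulr1z ltr_pdivrMr // ler_pdivlMr //.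
rewrite -[L *~ _]mulrzl mulrNz; set k' := k%:~R.
by move=> h1 h2; apply/andP; split; lra.
Qed.

(** At [(s, t)], [PP] is half the second derivative in [t] of the squared distance from [g s] to
    [g t], and [cr] is the cross product of the velocity at [s] with the acceleration at [t]. Moving
    the base point from [g s] by a unit normal [u] changes [PP] by the product of [u] with the
    acceleration, whose square times [N s] is [cr ^+ 2]. *)
Let PP (z : P) := N z.2 + (x z.2 - x z.1) * x2 z.2 + (y z.2 - y z.1) * y2 z.2.
Let cr (z : P) := x1 z.1 * y2 z.2 - y1 z.1 * x2 z.2.

Let c1 := continuous_fst_comp.
Let c2 := continuous_snd_comp.

Let PP_C : continuous PP.
Proof.
apply: contD; last by apply: contM; [apply: contB; [exact: c2|exact: c1]|exact: c2].
apply: contD; last by apply: contM; [apply: contB; [exact: c2|exact: c1]|exact: c2].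
by apply: contD; apply: contX; exact: c2.
Qed.

Let cr_C : continuous cr.
Proof. by apply: contB; apply: contM; [exact: c1|exact: c2|exact: c1|exact: c2]. Qed.

Lemma speed_gt0 t : 0 < N t.
Proof.
rewrite lt_neqAle addr_ge0 ?sqr_ge0 // andbT eq_sym; apply/eqP => N0.
by have := curv t; rewrite -/(N t) N0 expr0n /= ltNge sqr_ge0.
Qed.

(** On the diagonal [PP] is [N] and the second inequality is [curv]; continuity carries both to
    nearby pairs, with one [d] for all feet [s]. *)
Lemma curvature_near t0 : exists2 d : R, 0 < d & forall s t, `|s - t0| < d -> `|t - t0| < d ->
  0 < PP (s, t) /\ cr (s, t) ^+ 2 < PP (s, t) ^+ 2 * N s.
Proof.
have PP0 : PP (t0, t0) = N t0 by rewrite /PP /= !subrr !mul0r !addr0.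
have [|d d0 Pd] := @positive_near_diag PP t0 PP_C; first by rewrite PP0 speed_gt0.
pose Q z := PP z ^+ 2 * N z.1 - cr z ^+ 2.
have QC : continuous Q.
  apply: contB; last exact: contX.
  apply: contM; first exact: contX.
  by apply: contD; apply: contX; exact: c1.
have [|d' d'0 Qd] := @positive_near_diag Q t0 QC.
  have := curv t0; rewrite /Q PP0 /cr /= -/(N t0) -subr_gt0.
  by rewrite !exprS expr0 mulr1 mulrA.
exists (Num.min d d'); first by rewrite lt_min d0.
move=> s t; rewrite !lt_min => /andP[sd sd'] /andP[td td']; split; first exact: Pd.
by have := Qd s t sd' td'; rewrite subr_gt0.
Qed.

(** With the centre [a] on the normal at [s], the squared distance from [a] to the curve is critical
    at [s], and [curvature_near] makes it convex on the window. *)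
Lemma normal_disk_avoids t0 : exists2 d : R, 0 < d & forall s t (a : P),
  `|s - t0| < d -> `|t - t0| < d -> sqd a (g s) = 1 ->
  (a.1 - x s) * x1 s + (a.2 - y s) * y1 s = 0 -> 1 <= sqd a (g t).
Proof.
have [d d0 cd] := curvature_near t0; exists d => // s t a sd td as1 ort.
pose h c := (x c - a.1) ^+ 2 + (y c - a.2) ^+ 2.
pose h1 c := 2 * ((x c - a.1) * x1 c + (y c - a.2) * y1 c).
pose h2 c := 2 * (N c + (x c - a.1) * x2 c + (y c - a.2) * y2 c).
have hE c : h c = sqd a (g c) by rewrite sqdC.
rewrite -as1 -!hE.
apply: (@convex_critical_min _ h h1 h2 t0 d s t) => //.
- move=> c; apply: is_derive_eq; rewrite /h1 /GRing.scale /=; ring.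
- move=> c; apply: is_derive_eq; rewrite /h2 /N /GRing.scale /=; ring.
- move=> c cd'; rewrite /h2 mulr_ge0 //.
  have [Pp Pc] := cd s c sd cd'.
  set u1 := a.1 - x s in ort; set u2 := a.2 - y s in ort.
  have u1u2 : u1 ^+ 2 + u2 ^+ 2 = 1 by rewrite -as1.
  (* As [u] is a unit vector orthogonal to the velocity at [s], that velocity is [l] times [u]
     turned by a right angle, and [N s = l ^+ 2]. *)
  have lam : cr (s, c) ^+ 2 = (u1 * x2 c + u2 * y2 c) ^+ 2 * N s.
    pose l := u1 * y1 s - u2 * x1 s.
    have w1 : x1 s = - l * u2.
      have : (u1 ^+ 2 + u2 ^+ 2) * x1 s + l * u2 = u1 * (u1 * x1 s + u2 * y1 s).
        by rewrite /l; ring.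
      by rewrite u1u2 ort; lra.
    have w2 : y1 s = l * u1.
      have : (u1 ^+ 2 + u2 ^+ 2) * y1 s - l * u1 = u2 * (u1 * x1 s + u2 * y1 s).
        by rewrite /l; ring.
      by rewrite u1u2 ort; lra.
    have Nl : N s = l ^+ 2 by rewrite -[RHS]mulr1 -u1u2 /N w1 w2; ring.
    by rewrite Nl /cr /= w1 w2; ring.
  move: Pc; rewrite lam ltr_pM2r ?speed_gt0 //.
  rewrite -norm_lt_sqr // ltr_norml => /andP[_].
  rewrite /PP /= /u1 /u2; lra.
- by rewrite /h1; move: ort; lra.
Qed.

(** By injectivity the distance to [g t0] is positive on the compact rest of the period, so its
    minimum there bounds [e]. The cap at 1 later keeps a point closer than 1 to its foot. *)
Lemma near_point_near_param t0 d : 0 < d -> 2 * d < L ->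
  exists2 e : R, 0 < e <= 1 & forall t, edist (g t) (g t0) < e ->
    exists2 t', `|t' - t0| < d & g t' = g t.
Proof.
move=> d0 dL.
have ab : t0 + d <= t0 + L - d by lra.
pose f t := edist (g t) (g t0).
have fC : continuous f.
  move=> t; apply: (@continuous_comp _ _ _ g (fun q => edist q (g t0))).
    exact: cont_pair.
  exact: continuous_edist.
have [c] := EVT_min ab (continuous_subspaceT fC).
rewrite in_itv /= => /andP[c1' c2'] fmin.
have fc : 0 < f c.
  rewrite lt_neqAle edist_ge0 andbT eq_sym; apply/eqP => /edist0_eq[] h1 h2.
  have : c = t0 by apply: inj => //; rewrite ger0_norm; lra.
  lra.
exists (Num.min (f c) 1); first by rewrite lt_min fc ltr01 ge_min lexx orbT.
move=> t; rewrite lt_min => /andP[tf _].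
have [t' /andP[t1 t2] gt'] := loop_reduce (t0 - d) t.
rewrite -gt' in tf.
have nin s : t0 + d <= s <= t0 + L - d -> g s = g t' -> False.
  move=> /andP[s1 s2] gs; have := fmin s; rewrite in_itv /= s1 s2 => /(_ isT).
  by rewrite /f gs leNgt tf.
exists t' => //; rewrite ltr_distl; apply/andP; split.
  (* The half-open window contains its left end [t0 - d]; one period later this is the right end of
     the compact interval, where the curve is too far from [g t0]. *)
  rewrite lt_neqAle t1 andbT; apply/eqP => td.
  by apply: (nin (t' + L)); [lra|rewrite /g xper yper].
by rewrite ltNge; apply/negP => td; apply: (nin t') => //; lra.
Qed.

(** A nearest parameter on the closed window might be an endpoint, where the derivative need not
    vanish. But its point is within [e] of [g t0], so [near] and injectivity put it in the open
    window. *)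
Lemma foot_point t0 d e p : 0 < d -> 2 * d < L ->
  (forall t, edist (g t) (g t0) < e ->  exists2 t', `|t' - t0| < d & g t' = g t) ->
  edist p (g t0) < e / 2 ->
  exists c, [/\ `|c - t0| < d, edist p (g c) <= edist p (g t0) &
    (p.1 - x c) * x1 c + (p.2 - y c) * y1 c = 0].
Proof.
move=> d0 dL near pe.
have ab : t0 - d <= t0 + d by lra.
pose f t := (x t - p.1) ^+ 2 + (y t - p.2) ^+ 2.
have fE t : f t = sqd (g t) p by [].
pose f1 t := 2 * ((x t - p.1) * x1 t + (y t - p.2) * y1 t).
have fD (t : R) : is_derive t 1 f (f1 t).
  by apply: is_derive_eq; rewrite /f1 /GRing.scale /=; ring.
have [c] := EVT_min ab (continuous_subspaceT (is_derive_continuous fD)).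
rewrite in_itv /= => /andP[cd1 cd2] fmin.
have pc : edist p (g c) <= edist p (g t0).
  rewrite edist_le ?edist_ge0 // edist_sqr !(sqdC p) -!fE; apply: fmin.
  by rewrite in_itv /=; apply/andP; split; lra.
have gc : edist (g c) (g t0) < e.
  have := edist_triangle p (g c) (g t0); rewrite (edistC (g c) p); lra.
have [c' c'd gc'] := near c gc.
have cc' : c' = c.
  case: gc' => h1 h2; apply: inj => //.
  by move: c'd; rewrite !ltr_distl => /andP[? ?]; apply/andP; split; lra.
rewrite cc' in c'd; exists c; split => //.
have [_] : is_derive (c : R) 1 f 0.
  apply: (@derive1_at_min _ f (t0 - d) (t0 + d)) => //.
  - by rewrite in_itv /= -ltr_distl.
  - move=> s; rewrite in_itv /= => /andP[? ?]; apply: fmin.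
    by rewrite in_itv /=; apply/andP; split; lra.
by rewrite derive_val /f1; lra.
Qed.

Hypothesis FC : continuous F.
Hypothesis F0 : forall p, F p = 0 <-> exists t, p = g t.

(* The disk is centred on the ray from the foot point of p through p; it avoids the
   curve near t0, so by convexity F cannot change sign on its part near t0. *)
Lemma unit_disk_in_side t0 : exists2 e : R, 0 < e & forall p,
  edist p (g t0) < e / 2 -> F p != 0 ->
  exists2 a, edist p a < 1 & forall z, edist z (g t0) < e -> edist z a < 1 -> 0 < F p * F z.
Proof.
have [d1 d10 avoid] := normal_disk_avoids t0.
pose d := Num.min d1 (L / 4).
have d0 : 0 < d by rewrite lt_min d10 divr_gt0.
have dd1 : d <= d1 by rewrite ge_min lexx.
have dL : 2 * d < L.
  by have : d <= L / 4 by [rewrite ge_min lexx orbT]; lra.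
have [e /andP[e0 e1] near] := near_point_near_param t0 d0 dL.
exists e => // p pe Fp.
have [c [cd pc ort]] := foot_point d0 dL near pe.
set r := edist p (g c) in pc.
have r2 : (p.1 - x c) ^+ 2 + (p.2 - y c) ^+ 2 = r ^+ 2 by rewrite /r edist_sqr.
have r0 : 0 < r.
  rewrite lt_neqAle edist_ge0 andbT eq_sym; apply/eqP => /edist0_eq pg.
  by move/eqP: Fp; apply; rewrite pg; apply/F0; exists c.
have r1 : r < 1 by lra.
pose a : P := (x c + (p.1 - x c) / r, y c + (p.2 - y c) / r).
have ag : sqd a (g c) = 1.
  have -> : sqd a (g c) = ((p.1 - x c) ^+ 2 + (p.2 - y c) ^+ 2) / r ^+ 2.
    by rewrite /sqd /a /=; field; rewrite gt_eqF.
  by rewrite r2 divff // expf_neq0 // gt_eqF.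
have pa : edist p a < 1.
  rewrite edist_lt1.
  have -> : sqd p a = ((p.1 - x c) ^+ 2 + (p.2 - y c) ^+ 2) * (r - 1) ^+ 2 / r ^+ 2.
    by rewrite /sqd /a /=; field; rewrite gt_eqF.
  rewrite r2 mulrAC divff ?mul1r ?expf_neq0 ?gt_eqF //.
  by rewrite -[ltRHS](expr1n _ 2) -norm_lt_sqr // ltr_norml; apply/andP; split; lra.
exists a => // z ze za; rewrite ltNge; apply/negP => Fpz.
pose f s := F (lerp p z s).
have fC : continuous f.
  by move=> s; apply: continuous_comp; [exact: continuous_lerp|exact: FC].
have f01 : f 0 = F p /\ f 1 = F z.
  by rewrite /f /lerp !mul0r !addr0 !mul1r !(addrC _ (_ - _)) !subrK -!surjective_pairing.
have [|s] := @IVT _ f 0 1 0 ler01 (continuous_subspaceT fC).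
  have [-> ->] := f01; rewrite ge_min le_max.
  have [Fp0|Fp0] := leP (F p) 0; last first.
    by move: Fpz; rewrite pmulr_rle0 // (ltW Fp0) => ->.
  have Fn : F p < 0 by rewrite lt_neqAle Fp.
  by move: Fpz; rewrite nmulr_rle0 // => ->; rewrite orbT.
rewrite in_itv /= => s01 /F0[t gt].
have [t' t'd gt'] : exists2 t', `|t' - t0| < d & g t' = g t.
  by apply: near; rewrite -gt; apply: edist_lerp => //; lra.
have : edist (lerp p z s) a < 1 by exact: edist_lerp.
rewrite gt -gt' edistC edist_lt1; apply/negP; rewrite -leNgt.
apply: (avoid c) => //; first exact: lt_le_trans cd dd1.
  exact: lt_le_trans t'd dd1.
rewrite /a /= !(addrAC _ _ (- _)) !subrr !add0r.
by rewrite !(mulrAC _ r^-1) -mulrDl ort mul0r.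
Qed.

Hypothesis Fneg : forall t e, 0 < e -> exists2 q, edist q (g t) < e & F q < 0.

Let B : set P := [set p | 0 < F p].

Let nbhs_pos p : 0 < F p -> nbhs p B.
Proof.
move=> Fp; have h : nbhs (F p) [set x | 0 < x].
  by apply: open_nbhs_nbhs; split => //; exact: open_gt.
exact: (FC h).
Qed.

Let nbhs_neg p : F p < 0 -> nbhs p [set p | F p < 0].
Proof.
move=> Fp; have h : nbhs (F p) [set x | x < 0].
  by apply: open_nbhs_nbhs; split => //; exact: open_lt.
exact: (FC h).
Qed.

Lemma locally_drawable_with_off_curve (dr : set P -> Prop) :
  dr setT -> dr set0 ->
  (forall t0, exists2 e : R, 0 < e & exists2 D, dr D &
     forall p, edist p (g t0) < e -> B p <-> D p) ->
  locally_drawable_with dr B.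
Proof.
move=> drT dr0 onc p; have [Fp|Fp|/F0[t0 ->]] := ltgtP (F p) 0.
- exists [set p | F p < 0]; split; first exact: nbhs_neg.
  exists set0; split=> //; apply/seteqP; split => q /= [Fq Bq] //.
  by move: (lt_trans Fq Bq); rewrite ltxx.
- exists B; split; first exact: nbhs_pos.
  by exists setT; split=> //; rewrite setIid setIT.
- have [e e0 [D drD BD]] := onc t0.
  exists [set q | edist q (g t0) < e]; split.
    by apply/nbhs_edist; exists e.
  by exists D; split=> //; apply/seteqP; split=> q /= [qe /(BD q qe)].
Qed.

(** One stroke suffices: all open disks that, near [g t0], stay on the positive side. Every nearby
    point of that side is reached by [unit_disk_in_side]. *)
Lemma loop_locally_drawable : locally_drawable B.
Proof.
have dr1 A : drawable (Nopen A) by exists 1%N; exists A.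
apply: locally_drawable_with_off_curve => [||t0].
- rewrite (_ : setT = Nopen setT) //; apply/seteqP; split => // p _.
  by exists p => //; rewrite edistxx.
- by rewrite (_ : set0 = Nopen set0) //; apply/seteqP; split => // p [].
have [e e0 side] := unit_disk_in_side t0.
exists (e / 2); first by rewrite divr_gt0.
exists (Nopen [set a | forall z, edist z (g t0) < e -> edist z a < 1 -> B z]) => //.
move=> p pe; split.
  move=> Bp; have [|a pa az] := side p pe; first by rewrite gt_eqF.
  by exists a => // z ze za; have := az z ze za; rewrite pmulr_rgt0.
by move=> [a /= az pa]; apply: az => //; lra.
Qed.

(** [B] is open, so painting closed disks would cover curve points. Instead the whole plane is
    painted and the negative side together with the curve is erased, by closed disks whose interior
    is negative near [g t0]. *)
Lemma loop_locally_cdrawable : locally_cdrawable B.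
Proof.
have cT : setT = Nclosed (setT : set P).
  by apply/seteqP; split => // p _; exists p => //; rewrite edistxx.
have dr1 A : cdrawable (Nclosed A) by exists 1%N; exists A.
apply: locally_drawable_with_off_curve => [||t0].
- by rewrite cT.
- by rewrite (_ : set0 = Nclosed set0) //; apply/seteqP; split => // p [].
have [e e0 side] := unit_disk_in_side t0.
pose K : set P := [set a | forall z, edist z (g t0) < e -> edist z a < 1 -> F z < 0].
exists (e / 2); first by rewrite divr_gt0.
exists (setT `\` Nclosed K).
  exists 2%N; exists setT; last by exists K.
  by rewrite cT; exists setT.
have negK p : edist p (g t0) < e / 2 -> F p < 0 -> exists2 a, K a & edist p a < 1.
  move=> pe Fp; have [|a pa az] := side p pe; first by rewrite lt_eqF.
  by exists a => // z ze za; have := az z ze za; rewrite nmulr_rgt0.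
have cK : closed K.
  rewrite -openC; apply: open_edist => a /= /existsNP[z /not_implyP[ze]].
  move=> /not_implyP[za nFz]; exists (1 - edist z a); first by rewrite subr_gt0.
  move=> b ba /(_ z ze) Kb; apply: nFz; apply: Kb.
  by have := edist_triangle a z b; rewrite (edistC a b); lra.
move=> p pe; split => [Bp|[_ nK]].
  split=> // -[a Ka pa].
  have /nbhs_edist[r r0 rB] : nbhs p (B `&` [set q | edist q (g t0) < e]).
    apply: filterI; first exact: nbhs_pos.
    apply/nbhs_edist; exists (e / 2); first by rewrite divr_gt0.
    move=> q qp /=.
    by have := edist_triangle p q (g t0); lra.
  have [ap|ap] := ltP (edist p a) 1.
    have pe' : edist p (g t0) < e by lra.
    by have := Ka p pe' ap; rewrite ltNge ltW.
  (* Here [p] is on the rim of the disk around [a]. A small move towards [a] stays in the open set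
     [B] but enters the open disk, where [F] is negative. *)
  pose s := Num.min (r / 2) (1 / 2).
  have s0 : 0 < s by rewrite lt_min !divr_gt0.
  have sr : s <= r / 2 by rewrite ge_min lexx.
  have s1 : s <= 1 / 2 by rewrite ge_min lexx orbT.
  have [] := rB (lerp p a s).
    by rewrite edist_lerpl 1?ltW // (edistC a p); have : edist p a = 1 by [lra]; nra.
  move=> Bs es; have : F (lerp p a s) < 0.
    apply: Ka => //; rewrite edist_lt1.
    have s01 : 0 <= s <= 1 by apply/andP; split; lra.
    apply: le_lt_trans (sqd_lerp _ _ _ s01) _.
    by rewrite edist_le1 in pa; rewrite {2}/sqd !subrr expr0n /= addr0 mulr0 addr0; nra.
  by rewrite ltNge ltW.
rewrite /B /= ltNge; apply/negP => Fp; apply: nK.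
move: Fp; rewrite le_eqVlt => /orP[/eqP Fp|Fp]; last first.
  by have [a Ka pa] := negK p pe Fp; exists a => //; exact: ltW.
have [t pt] := (F0 p).1 Fp.
(* A curve point is a limit of negative points, each in an open disk centred in [K]; closedness of
   [K] gives a closed disk reaching the curve point itself. *)
have [b b0|a Ka ap] := @closed_near _ K p 1 cK; last by exists a => //; rewrite edistC.
have c0 : 0 < Num.min b (e / 2 - edist p (g t0)) by rewrite lt_min b0 subr_gt0.
have [q] := Fneg t c0; rewrite -pt lt_min => /andP[qb qe] Fq.
have [|a Ka qa] := negK q _ Fq.
  by have := edist_triangle p q (g t0); lra.
by exists a => //; have := edist_triangle q a p; rewrite (edistC a q); lra.
Qed.

End LocallyDrawable.

(** * Trigonometry *)

Section Trigonometry.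
Variable R : realType.
Implicit Types a b t x : R.

Lemma cos_int (k : int) x : cos (x + (pi *+ 2) *~ k) = cos x.
Proof. exact: periodic_int (@cosD2pi R) k x. Qed.

Lemma sin_int (k : int) x : sin (x + (pi *+ 2) *~ k) = sin x.
Proof. exact: periodic_int (@sinD2pi R) k x. Qed.

Lemma sin_eq0P x : sin x = 0 -> exists k : int, x = pi *~ k.
Proof.
move=> sx0; pose k := Num.floor (x / pi); exists k.
have p0 := @pi_gt0 R.
have per : periodic (fun t : R => sin t ^+ 2) pi by move=> t; rewrite sinDpi sqrrN.
pose r := x + pi *~ (- k).
have s0 : sin r = 0.
  by apply/eqP; rewrite -sqrf_eq0 (periodic_int per) sx0 expr0n.
have : 0 <= r < pi.
  have := Num.Theory.floor_le (x / pi); have := Num.Theory.lt_succ_floor (x / pi).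
  rewrite -/k intrD mulr1z ltr_pdivrMr // ler_pdivlMr //.
  by rewrite /r -[pi *~ _]mulrzl mulrNz => h1 h2; apply/andP; split; lra.
case/andP; rewrite le_eqVlt => /orP[/eqP r0 _|r0 rp].
  by move: r0; rewrite /r mulrNz; lra.
by have : 0 < sin r by [rewrite sin_gt0_pi ?r0]; rewrite s0 ltxx.
Qed.

(** Sum-to-product: [cos a - cos b] is -2 times the product of the sines of the half sum and the
    half difference. *)
Lemma cos_eqP a b : cos a = cos b ->
  exists k : int, a = b + (pi *+ 2) *~ k \/ a = - b + (pi *+ 2) *~ k.
Proof.
move=> ab; pose u := (a + b) / 2; pose v := (a - b) / 2.
have : sin u * sin v = 0.
  have : cos (u + v) - cos (u - v) = - 2 * (sin u * sin v) by rewrite cosD cosB; ring.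
  have -> : u + v = a by rewrite /u /v; lra.
  have -> : u - v = b by rewrite /u /v; lra.
  by rewrite ab subrr => /esym/eqP; rewrite mulf_eq0 oppr_eq0 pnatr_eq0 /= => /eqP.
move/eqP; rewrite mulf_eq0 => /orP[]/eqP/sin_eq0P[k kE]; exists k; [right|left];
  move: kE; rewrite /u /v -[pi *~ k]mulrzr -[pi *+ 2 *~ k]mulrzr -[pi *+ 2]mulr_natr;
  move: (k%:~R) => z; lra.
Qed.

Lemma cos_half t : cos t = 1 - 2 * sin (t / 2) ^+ 2.
Proof.
rewrite [in LHS](_ : t = (t / 2) *+ 2); first by rewrite cos_mulr2n cos2sin2 mulr2n; ring.
by rewrite mulr2n; lra.
Qed.

Lemma cos_sin_eqP a b : cos a = cos b -> sin a = sin b ->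
  exists k : int, a = b + (pi *+ 2) *~ k.
Proof.
move=> cab sab; have : sin ((a - b) / 2) = 0.
  apply/eqP; rewrite -sqrf_eq0; apply/eqP.
  by have := cos_half (a - b); rewrite cosB cab sab -!expr2 cos2Dsin2; lra.
move=> /sin_eq0P[k kE]; exists k.
move: kE; rewrite -[pi *~ k]mulrzr -[pi *+ 2 *~ k]mulrzr -[pi *+ 2]mulr_natr.
by move: (k%:~R) => z; lra.
Qed.

Lemma polar_coordinates (p : R * R) :
  exists r t : R, 0 <= r /\ p = (r * cos t, r * sin t).
Proof.
case: p => a b; pose r := Num.sqrt (a ^+ 2 + b ^+ 2).
have r2 : r ^+ 2 = a ^+ 2 + b ^+ 2 by rewrite sqr_sqrtr // addr_ge0 ?sqr_ge0.
have [r0|rn0] := eqVneq r 0.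
  exists 0, 0; split=> //; rewrite !mul0r.
  move: r2; rewrite r0 expr0n /= => /esym/eqP.
  by rewrite paddr_eq0 ?sqr_ge0 // !sqrf_eq0 => /andP[/eqP -> /eqP ->].
have rp : 0 < r by rewrite lt_neqAle eq_sym rn0 sqrtr_ge0.
have ar : -1 <= a / r <= 1.
  rewrite -ler_norml norm_le_sqr // expr1n exprMn exprVn ler_pdivrMr ?exprn_gt0 //.
  by rewrite mul1r r2 lerDl sqr_ge0.
have ca : r * cos (acos (a / r)) = a.
  by rewrite acosK ?in_itv //= mulrC divfK.
have sa : r * sin (acos (a / r)) = `|b|.
  rewrite sin_acos // -(gtr0_norm rp) -sqrtr_sqr -sqrtrM ?sqr_ge0 // -sqrtr_sqr.
  by congr Num.sqrt; rewrite mulrBr mulr1 r2 exprMn exprVn r2; field; rewrite -r2 expf_neq0.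
exists r; have [b0|b0] := leP 0 b.
  by exists (acos (a / r)); split; [exact: ltW|rewrite ca sa ger0_norm].
exists (- acos (a / r)); split; first exact: ltW.
by rewrite cosN sinN mulrN ca sa ltr0_norm // opprK.
Qed.

Lemma sin_lt t : 0 < t -> sin t < t.
Proof.
move=> t0; have [t1|t1] := leP t 1; last exact: le_lt_trans (sin_le1 t) t1.
have [c /andP[c0 ct]] := mean_value (@is_derive_sin R) t0.
rewrite sin0 !subr0 => ->; rewrite gtr_pMl //.
have : 0 < sin (c / 2) by rewrite sin2_gt0 //; apply/andP; split; lra.
move=> s0; have : 0 < sin (c / 2) ^+ 2 by rewrite exprn_gt0.
by rewrite cos_half; lra.
Qed.

Lemma sin_le t : 0 <= t -> sin t <= t.
Proof. by rewrite le_eqVlt => /orP[/eqP <-|/sin_lt/ltW//]; rewrite sin0. Qed.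

(* sin (pi / 6) = 1 / 2 < pi / 6. *)
Lemma pi_gt3 : 3 < pi :> R.
Proof.
have p2 := @pi_ge2 R; have p4 : pi < 4 :> R by have := pihalf_lt2 R; lra.
have [y yE] : exists y : R, y = pi / 6 by exists (pi / 6).
have s0 : 0 < sin y by rewrite sin2_gt0 //; apply/andP; split; lra.
have : sin (y *+ 2 + y) = 1.
  by rewrite -(sin_pihalf R); congr sin; rewrite yE mulr2n; lra.
rewrite sinD sin_mulr2n cos_mulr2n mulr2n => h.
(* The triple-angle formula turns sin 3y = 1 into 4 s^3 - 3 s + 1 = 0 for s = sin y, and this cubic
   factors. *)
have : (sin y + 1) * (2 * sin y - 1) ^+ 2 = 0.
  have c2 := cos2sin2 y; move: h; rewrite !expr2 in c2 *; rewrite !mulrDr !mulrDl.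
  move: (cos y) (sin y) c2 => c s c2 h.
  have : s * (c * c) = s * (1 - s * s) by rewrite c2.
  by move: h; lra.
move/eqP; rewrite mulf_eq0 gt_eqF ?addr_gt0 //= sqrf_eq0 subr_eq0 => /eqP sE.
have : sin y < y by apply: sin_lt; lra.
lra.
Qed.

Lemma cos_ge_parabola t : 0 <= t -> 1 - t ^+ 2 / 2 <= cos t.
Proof.
move=> t0; rewrite cos_half.
have : sin (t / 2) ^+ 2 <= (t / 2) ^+ 2.
  rewrite -norm_le_sqr ?divr_ge0 // ler_norml sin_le ?divr_ge0 // andbT.
  have [t1|t1] := leP t 2; last by have := sin_geN1 (t / 2); lra.
  have : 0 <= sin (t / 2); last lra.
  by apply: sin_ge0_pi; have := pi_gt3; lra.
by rewrite exprMn expr2; lra.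
Qed.

Lemma sin_ge_half t : 0 <= t <= 1 -> t / 2 <= sin t.
Proof.
case/andP; rewrite le_eqVlt => /orP[/eqP <- _|t0 t1]; first by rewrite sin0 mul0r.
have [c /andP[c0 ct]] := mean_value (@is_derive_sin R) t0.
rewrite sin0 !subr0 => ->; rewrite mulrC ler_wpM2r ?ltW //.
by have := cos_ge_parabola (ltW c0); nra.
Qed.

Definition phase t : R := t + 4 * (sin t * cos t).

Lemma phaseE t : phase t = t + 2 * sin (t *+ 2).
Proof. by rewrite /phase sin_mulr2n mulr2n; ring. Qed.

Lemma phaseN t : phase (- t) = - phase t.
Proof. by rewrite /phase sinN cosN; ring. Qed.

Lemma phaseDpi t : phase (t + pi) = phase t + pi.
Proof. by rewrite /phase sinDpi cosDpi; ring. Qed.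

Lemma phase_int (k : int) t : phase (t + (pi *+ 2) *~ k) = phase t + (pi *+ 2) *~ k.
Proof. by rewrite /phase sin_int cos_int addrAC. Qed.

(* The upper bound is where pi > 3 is needed: the two arguments cover
   t < pi - 2 and t > pi / 3 respectively. *)
Lemma phase_bound t : 0 < t < pi -> 0 < phase t < pi.
Proof.
have low s : 0 < s <= pi / 2 -> 0 < phase s < pi.
  move=> /andP[s0 sp]; have p3 := pi_gt3; apply/andP; split.
    rewrite ltr_wpDr // !mulr_ge0 //; first by apply: sin_ge0_pi; lra.
    by apply: cos_ge0_pihalf; lra.
  rewrite phaseE; have [s2|s2] := ltP s (pi - 2).
    by have := sin_le1 (s *+ 2); lra.
  have : sin (s *+ 2) <= pi - s *+ 2.
    rewrite -[s *+ 2](subKr pi) sinB sinpi cospi mul0r mulN1r sub0r opprK.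
    by rewrite subKr; apply: sin_le; rewrite mulr2n; lra.
  by rewrite mulr2n; lra.
case/andP=> t0 tp; have [th|th] := leP t (pi / 2); first by apply: low; rewrite t0.
have /low : 0 < pi - t <= pi / 2 by lra.
have -> : phase (pi - t) = pi - phase t by rewrite addrC phaseDpi phaseN addrC.
by lra.
Qed.

End Trigonometry.

(** * Complex powers and tools for polar coordinates *)

Section PolarBasics.
Variable R : realType.
Local Notation P := (R * R)%type.

Lemma cont_max (T : topologicalType) (f g : T -> R) :
  continuous f -> continuous g -> continuous (fun t => Num.max (f t) (g t)).
Proof. by move=> cf cg t; apply: (continuous_max (cf t) (cg t)). Qed.

Lemma cont_min (T : topologicalType) (f g : T -> R) :
  continuous f -> continuous g -> continuous (fun t => Num.min (f t) (g t)).
Proof. by move=> cf cg t; apply: (continuous_min (cf t) (cg t)). Qed.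

Lemma cont_id : continuous (fun t : R => t).
Proof. by move=> t; exact: cvg_id. Qed.

(** Powers of the complex number [p.1 + i p.2]. They make r^m cos (m theta) a polynomial, so that no
    continuous choice of angle is needed. *)
Fixpoint cpow (p : P) (n : nat) : P :=
  if n is k.+1 then
    (p.1 * (cpow p k).1 - p.2 * (cpow p k).2, p.1 * (cpow p k).2 + p.2 * (cpow p k).1)
  else (1, 0).

Lemma de_moivre (r t : R) n :
  cpow (r * cos t, r * sin t) n = (r ^+ n * cos (t *+ n), r ^+ n * sin (t *+ n)).
Proof.
elim: n => [|n IHn] /=; first by rewrite cos0 sin0 mulr0 mulr1.
rewrite IHn /= exprS mulrS cosD sinD; congr pair; ring.
Qed.

Lemma continuous_cpow n : continuous (fun p : P => (cpow p n).1) /\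
                          continuous (fun p : P => (cpow p n).2).
Proof.
have c1 : continuous (fun q : P => q.1) by move=> q; exact: cvg_fst.
have c2 : continuous (fun q : P => q.2) by move=> q; exact: cvg_snd.
elim: n => [|n [IH1 IH2]] /=; first by split; exact: cont_cst.
by split; [apply: contB|apply: contD]; apply: contM.
Qed.

Lemma continuous_path_near (c : R -> P) a e : continuous c -> 0 < e ->
  exists2 d, 0 < d & forall b, `|b - a| < d -> edist (c b) (c a) < e.
Proof.
move=> cc e0; have h : nbhs (c a) [set q | edist q (c a) < e].
  by apply/nbhs_edist; exists e.
have /nbhs_ballP[d /= d0 dh] := cc a _ h.
by exists d => // b bd; apply: dh; rewrite /ball /= distrC.
Qed.

Lemma cos_shrink (u s : R) : `|u| <= pi -> 0 <= s <= 1 -> cos u <= cos (s * u).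
Proof.
move=> upi /andP[s0 s1].
rewrite -[cos u]cos_norm -[cos (s * u)]cos_norm normrM (ger0_norm s0).
have u0 := normr_ge0 u.
have su : s * `|u| <= `|u| by rewrite ler_piMl.
rewrite leNgt ltr_cos ?in_itv /= ?u0 ?mulr_ge0 ?(le_trans su) //.
by rewrite -leNgt.
Qed.

Lemma cos_lt1 (t : R) : 0 < t < 4 -> cos t < 1.
Proof.
move=> t04; have s0 : 0 < sin (t / 2) by rewrite sin2_gt0 //; lra.
by rewrite cos_half; have : 0 < sin (t / 2) ^+ 2 by [rewrite exprn_gt0]; lra.
Qed.

Lemma sin_pi_int (k : int) : sin (pi *~ k) = 0 :> R.
Proof.
have per : periodic (fun t : R => sin t ^+ 2) pi by move=> t; rewrite sinDpi sqrrN.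
by apply/eqP; rewrite -sqrf_eq0 -[pi *~ k]add0r (periodic_int per) sin0 expr0n.
Qed.

(** Replacing [t] by [acos (cos t)], which changes it only by sign and full turns, reduces this to
    [phase_bound]. Geometrically, the curve meets the rays on which m theta is a multiple of pi only
    at its extreme radii. *)
Lemma sin_phase_neq0 (t : R) : sin t != 0 -> sin (phase t) != 0.
Proof.
move=> st; have c1 : -1 <= cos t <= 1 by rewrite cos_geN1 cos_le1.
pose u := acos (cos t).
have cu : cos u = cos t by rewrite acosK ?in_itv.
have su : sin u != 0.
  by rewrite -sqrf_eq0 sin2cos2 cu -sin2cos2 sqrf_eq0.
have u0 : 0 < u < pi.
  rewrite !lt_neqAle acos_ge0 // acos_lepi // !andbT; apply/andP; split.
    by apply: contraNneq su => <-; rewrite sin0.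
  by apply: contraNneq su => ->; rewrite sinpi.
have su' : sin (phase u) != 0 by rewrite gt_eqF // sin_gt0_pi // phase_bound.
have [k [->|->]] := cos_eqP (esym cu); rewrite phase_int sin_int //.
by rewrite phaseN sinN oppr_eq0.
Qed.

End PolarBasics.

(** * The meander and its interior *)

Section Meander.
Variables (R : realType) (m : nat).
Local Notation P := (R * R)%type.
Variable mu : R.
(* That is, mu = m%:R. *)
Hypothesis muE : forall a, mu * a = a *+ m.
Hypothesis mu_ge : 100 * 10 <= mu.
Local Notation rho := (9 / 20 * mu).

(** The argument [a] is [m] times the polar angle, the scale on which [phase] lives. *)
Definition pol (r a : R) : P := (r * cos (a / mu), r * sin (a / mu)).
Definition rad (t : R) : R := 9 / 20 * mu + 4 * cos t.
Definition meander t : P := pol (rad t) (phase t).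

Definition clamp (y : R) : R := Num.min 1 (Num.max (-1) y).

(* profile (cos t) = cos (phase t), so inside the annulus the curve is
   cos (m theta) = profile ((r - rho) / 4). *)
Definition profile (y : R) : R :=
  let q := Num.sqrt (1 - y ^+ 2) in y * cos (4 * (q * y)) - q * sin (4 * (q * y)).

(** The equation of the curve multiplied by r^m, which makes it continuous at the origin. Off the
    annulus [clamp] freezes [profile] at -1 inside and 1 outside, which gives only weak signs; the
    two [Num.max] terms make them strict. *)
Definition level (p : P) : R :=
  let r := edist p (0, 0) in
  (cpow p m).1 - r ^+ m * profile (clamp ((r - rho) / 4))
  + Num.max 0 (rho - 4 - r) - Num.max 0 (r - rho - 4).

Let mu0 : 0 < mu. Proof. by have := mu_ge; lra. Qed.
Let mun0 : mu != 0. Proof. by rewrite gt_eqF. Qed.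

Lemma rad_gt0 t : 0 < rad t.
Proof. by rewrite /rad; have := cos_geN1 t; have := mu_ge; lra. Qed.

Lemma profile_cos t : profile (cos t) = cos (phase t).
Proof.
rewrite /profile -sin2cos2 sqrtr_sqr /phase cosD.
have [st|st] := ger0P (sin t); first by ring.
by rewrite (_ : 4 * (- sin t * cos t) = - (4 * (sin t * cos t))) ?cosN ?sinN; ring.
Qed.

Lemma continuous_level : continuous level.
Proof.
have er : continuous (fun p : P => edist p (0, 0)) by exact: continuous_edist.
have ec : continuous (fun p : P => clamp ((edist p (0, 0) - rho) / 4)).
  apply: cont_min; first exact: cont_cst.
  apply: cont_max; first exact: cont_cst.
  by apply: contM; [apply: contB => //|]; exact: cont_cst.
have pr : continuous profile.
  have q : continuous (fun y : R => Num.sqrt (1 - y ^+ 2)).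
    apply: cont_comp; first exact: sqrt_continuous.
    by apply: contB; [exact: cont_cst|apply: contX; exact: cont_id].
  have qy : continuous (fun y : R => 4 * (Num.sqrt (1 - y ^+ 2) * y)).
    by apply: contM; [exact: cont_cst|apply: contM => //; exact: cont_id].
  apply: contB; apply: contM => //; first exact: cont_id.
    by apply: cont_comp => //; exact: continuous_cos.
  by apply: cont_comp => //; exact: continuous_sin.
apply: contB; first apply: contD; first apply: contB.
- exact: (continuous_cpow R m).1.
- by apply: contM; [exact: contX|exact: cont_comp].
- by apply: cont_max; [exact: cont_cst|apply: contB => //; exact: cont_cst].
- apply: cont_max; first exact: cont_cst.
  by apply: contB; [apply: contB => //|]; exact: cont_cst.
Qed.

Lemma edist_pol r a : 0 <= r -> edist (pol r a) (0, 0) = r.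
Proof.
move=> r0; apply/eqP; rewrite -(eqrXn2 (n := 2)) ?edist_ge0 // edist_sqr /sqd /pol /=.
by rewrite !subr0 !exprMn -mulrDr cos2Dsin2 mulr1.
Qed.

Lemma level_pol r a : 0 <= r -> level (pol r a) =
  r ^+ m * (cos a - profile (clamp ((r - rho) / 4)))
  + Num.max 0 (rho - 4 - r) - Num.max 0 (r - rho - 4).
Proof.
move=> r0; rewrite /level edist_pol // /pol de_moivre /= -muE.
have -> : mu * (a / mu) = a by rewrite mulrC divfK.
by rewrite (mulrBr (r ^+ m) (cos a)).
Qed.

Lemma clamp_id y : -1 <= y <= 1 -> clamp y = y.
Proof. by move=> /andP[y1 y2]; rewrite /clamp max_r // min_r. Qed.

Lemma level_rad t a :
  level (pol (rad t) a) = rad t ^+ m * (cos a - cos (phase t)).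
Proof.
have r0 := rad_gt0 t; rewrite level_pol ?ltW //.
have -> : (rad t - rho) / 4 = cos t by rewrite /rad; field.
have c1 := cos_geN1 t; have c2 := cos_le1 t.
rewrite clamp_id ?c1 // profile_cos.
by rewrite !max_l ?addr0 ?subr0 // /rad; lra.
Qed.

Lemma level_inside r a : 0 <= r < rho - 4 -> 0 < level (pol r a).
Proof.
move=> /andP[r0 r1]; rewrite level_pol //.
have -> : clamp ((r - rho) / 4) = cos pi.
  by rewrite cospi /clamp max_l ?min_r //; lra.
rewrite profile_cos -[pi]add0r phaseDpi /phase sin0 mul0r mulr0 !add0r cospi.
rewrite max_r ?max_l; [|lra|lra].
have : 0 <= r ^+ m * (cos a - - 1).
  by rewrite mulr_ge0 ?exprn_ge0 //; have := cos_geN1 a; lra.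
lra.
Qed.

Lemma level_outside r a : rho + 4 < r -> level (pol r a) < 0.
Proof.
move=> r1; have r0 : 0 <= r by have := mu_ge; lra.
rewrite level_pol //.
have -> : clamp ((r - rho) / 4) = cos 0.
  by rewrite cos0 /clamp min_l // le_max; apply/orP; right; lra.
rewrite profile_cos /phase sin0 mul0r mulr0 !addr0 cos0.
rewrite max_l ?max_r; [|lra|lra].
have : r ^+ m * (1 - cos a) >= 0.
  by rewrite mulr_ge0 ?exprn_ge0 //; have := cos_le1 a; lra.
lra.
Qed.

Lemma rad_onto r : rho - 4 <= r <= rho + 4 -> exists2 t, 0 <= t <= pi & rad t = r.
Proof.
move=> rr; have c1 : -1 <= (r - rho) / 4 <= 1 by lra.
exists (acos ((r - rho) / 4)); first by rewrite acos_ge0 // acos_lepi.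
by rewrite /rad acosK ?in_itv //=; field.
Qed.

Lemma plane_pol p : exists r a, 0 <= r /\ p = pol r a.
Proof.
have [r [t [r0 ->]]] := polar_coordinates p; exists r, (mu * t); split=> //.
by rewrite /pol [mu * t]mulrC mulfK.
Qed.

Lemma rad_int (k : int) t : rad (t + (pi *+ 2) *~ k) = rad t.
Proof. by rewrite /rad cos_int. Qed.

(** Equal cosines leave [a] equal to [phase t] or its opposite modulo 2 pi; by oddness and
    periodicity both are phases of parameters with the radius of [t]. *)
Lemma level_eq0P p : level p = 0 <-> exists t, p = meander t.
Proof.
split=> [|[t ->]]; last by rewrite level_rad subrr mulr0.
have [r [a [r0 ->]]] := plane_pol p => l0.
have [t _ tr] : exists2 t, 0 <= t <= pi & rad t = r.
  apply: rad_onto; apply/andP; split; rewrite leNgt; apply/negP => h.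
    have r0h : 0 <= r < rho - 4 by rewrite r0.
    by have := level_inside a r0h; rewrite l0 ltxx.
  by have := level_outside a h; rewrite l0 ltxx.
move: l0; rewrite -tr level_rad => /eqP; rewrite mulf_eq0 expf_eq0 gt_eqF ?rad_gt0 //.
rewrite andbF subr_eq0 => /eqP/cos_eqP[k [->|->]].
  by exists (t + (pi *+ 2) *~ k); rewrite /meander rad_int phase_int.
exists (- t + (pi *+ 2) *~ k).
by rewrite /meander rad_int phase_int phaseN /rad cosN.
Qed.

(** These rays are the escape routes to infinity: for t < pi the phase stays in [0, pi), so its
    cosine exceeds -1. *)
Lemma level_ray_neg r a : cos a = -1 -> rho - 4 < r -> level (pol r a) < 0.
Proof.
move=> ca r1; have [r2|r2] := ltP (rho + 4) r; first exact: level_outside.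
have [|t /andP[t0 tp] tr] := @rad_onto r; first by rewrite ltW.
rewrite -tr level_rad ca pmulr_rlt0 ?exprn_gt0 ?rad_gt0 // subr_lt0.
have t1 : t < pi.
  rewrite lt_neqAle tp andbT; apply/eqP => tE.
  by move: r1; rewrite -tr tE /rad cospi; lra.
rewrite -cospi ltr_cos ?in_itv /= ?lexx ?pi_ge0 //.
  have [->|tn0] := eqVneq t 0; first by rewrite /phase sin0 mul0r mulr0 addr0 pi_gt0.
  by have /phase_bound/andP[] : 0 < t < pi by rewrite lt_neqAle eq_sym tn0 t0.
have [->|tn0] := eqVneq t 0.
  by rewrite /phase sin0 mul0r mulr0 addr0 lexx pi_ge0.
by have /phase_bound/andP[/ltW-> /ltW->] : 0 < t < pi by rewrite lt_neqAle eq_sym tn0 t0.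
Qed.

Lemma continuous_pol_angle r : continuous (pol r).
Proof.
apply: cont_pair; apply: contM; try exact: cont_cst.
  apply: cont_comp; first exact: continuous_cos.
  by apply: contM; [exact: cont_id|exact: cont_cst].
apply: cont_comp; first exact: continuous_sin.
by apply: contM; [exact: cont_id|exact: cont_cst].
Qed.

Lemma continuous_pol_radius a : continuous (pol^~ a).
Proof. by apply: cont_pair; apply: contM; try exact: cont_cst; exact: cont_id. Qed.

Lemma is_derive_cosN (t : R) : is_derive t 1 (fun s : R => - cos s) (sin t).
Proof. by apply: is_derive_eq; rewrite opprK. Qed.

(** Usually a small turn lowers [cos a] and with it [level]. Where [cos a] is already -1 no turn
    helps, and the point moves outwards along the ray. *)
Lemma level_neg_near t e : 0 < e -> exists2 q, edist q (meander t) < e & level q < 0.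
Proof.
move=> e0; pose a := phase t.
have turn : (forall d : R, 0 < d -> exists2 b, `|b - a| < d & cos b < cos a) ->
    exists2 q, edist q (meander t) < e & level q < 0.
  have [d d0 dq] := @continuous_path_near _ (pol (rad t)) a e (@continuous_pol_angle _) e0.
  move=> /(_ d d0)[b bd cb]; exists (pol (rad t) b); first exact: dq.
  by rewrite level_rad pmulr_rlt0 ?exprn_gt0 ?rad_gt0 // subr_lt0.
have [sa|sa] := eqVneq (sin a) 0; last first.
  apply: turn => d d0.
  by apply: (decrease_near (@is_derive_cos R) _ d0); rewrite oppr_eq0.
have /eqP : `|cos a| = 1 by exact: sin0cos1.
rewrite eqr_norml => /andP[/orP[]/eqP ca _].
  apply: turn => d d0; pose h := Num.min (d / 2) 1.
  have h0 : 0 < h by rewrite lt_min divr_gt0 ?ltr01.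
  have hd : h <= d / 2 by rewrite ge_min lexx.
  have h1 : h <= 1 by rewrite ge_min lexx orbT.
  exists (a + h); first by rewrite addrAC subrr add0r gtr0_norm //; lra.
  by rewrite cosD sa mul0r subr0 ca mul1r cos_lt1 //; lra.
have [d d0 dq] := @continuous_path_near _ (pol^~ a) (rad t) e (@continuous_pol_radius _) e0.
exists (pol (rad t + d / 2) a).
  by apply: dq; rewrite addrAC subrr add0r gtr0_norm; lra.
by apply: level_ray_neg => //; rewrite /rad; have := cos_geN1 t; lra.
Qed.

(** Turning raises [cos a] unless the phase is a multiple of pi, which [sin t != 0] excludes; the
    necks satisfy this. *)
Lemma level_pos_near t e : sin t != 0 -> 0 < e ->
  exists2 q, edist q (meander t) < e & 0 < level q.
Proof.
move=> st e0; pose a := phase t.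
have [d d0 dq] := @continuous_path_near _ (pol (rad t)) a e (@continuous_pol_angle _) e0.
have [b bd cb] := decrease_near is_derive_cosN (sin_phase_neq0 st) d0.
exists (pol (rad t) b); first exact: dq.
rewrite level_rad pmulr_rgt0 ?exprn_gt0 ?rad_gt0 // subr_gt0.
by move: cb; rewrite ltrN2.
Qed.

Definition mx t := (meander t).1.
Definition my t := (meander t).2.

Lemma curve_imageE : curve_image mx my = [set p | level p = 0].
Proof.
apply/seteqP; split=> p /=.
  by move=> [t _ <-]; apply/level_eq0P; exists t; rewrite /mx /my; case: (meander t).
by move=> /level_eq0P[t ->]; exists t => //; rewrite /mx /my; case: (meander t).
Qed.

Lemma component_pos p q : 0 < level p ->
  connected_component (~` curve_image mx my) p q -> 0 < level q.
Proof.
rewrite curve_imageE => lp cq.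
set C := connected_component _ p in cq.
have Cp : C p by apply: connected_component_refl => /= l0; move: lp; rewrite l0 ltxx.
have Csub : C `<=` ~` [set p | level p = 0] by exact: connected_component_sub.
have : connected (level @` C).
  apply: connected_continuous_connected; first exact: component_connected.
  by apply: continuous_subspaceT; exact: continuous_level.
move=> /connected_intervalP itv; rewrite ltNge; apply/negP => lq.
have [|z Cz lz] := itv _ _ (imageP level cq) (imageP level Cp) 0.
  by rewrite lq ltW.
exact: Csub Cz lz.
Qed.

Lemma component_path (c : R -> P) : continuous c ->
  (forall s, 0 <= s <= 1 -> level (c s) < 0) ->
  connected_component (~` curve_image mx my) (c 0) (c 1).
Proof.
move=> cc neg; rewrite curve_imageE.
apply: (@connected_component_max _ _ (c @` `[0, 1])).
- by exists 0 => //=; rewrite in_itv /= lexx ler01.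
- by move=> _ [s /= + <-]; rewrite in_itv /= => /neg h l0; move: h; rewrite l0 ltxx.
- apply: connected_continuous_connected; first exact: segment_connected.
  exact: continuous_subspaceT.
- by exists 1 => //=; rewrite in_itv /= lexx ler01.
Qed.

Lemma odd_pi_near a : exists2 b : R, cos b = -1 & `|a - b| <= pi.
Proof.
have p0 : 0 < (pi *+ 2 : R) by rewrite mulrn_wgt0 // pi_gt0.
pose k := Num.floor (a / (pi *+ 2)).
exists (pi + (pi *+ 2) *~ k); first by rewrite cos_int cospi.
have := Num.Theory.floor_le (a / (pi *+ 2)).
have := Num.Theory.lt_succ_floor (a / (pi *+ 2)).
rewrite -/k intrD mulr1z ltr_pdivrMr // ler_pdivlMr //.
rewrite -[pi *+ 2 *~ k]mulrzr -mulr_natr; move: (k%:~R) => z h1 h2.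
by rewrite ler_norml; apply/andP; split; lra.
Qed.

(** At fixed radius, turning towards the nearest ray with cosine -1 never raises [level], since the
    angle enters only through its cosine, which falls all the way. From that ray one goes outwards
    past any bound [M]. *)
Lemma component_neg_unbounded p : level p < 0 ->
  ~ bounded_plane (connected_component (~` curve_image mx my) p).
Proof.
have [r [a [r0 ->]]] := plane_pol p => lp [M bnd].
have [b cb ab] := odd_pi_near a.
have r1 : rho - 4 < r.
  rewrite ltNge le_eqVlt; apply/negP => /orP[/eqP rE|h].
    have rE' : r = rad pi by rewrite rE /rad cospi; ring.
    move: lp; rewrite rE' level_rad pmulr_rlt0 ?exprn_gt0 ?rad_gt0 // subr_lt0.
    rewrite -[X in phase X]add0r phaseDpi /phase sin0 mul0r mulr0 !add0r cospi.
    by rewrite ltNge cos_geN1.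
  have r0h : 0 <= r < rho - 4 by rewrite r0.
  by move: (lt_trans lp (level_inside a r0h)); rewrite ltxx.
have rpos : 0 < r by have := mu_ge; lra.
have sb : sin b = 0 by apply: cos1sin0; rewrite cb normrN1.
have turn s : 0 <= s <= 1 -> level (pol r (a + s * (b - a))) < 0.
  move=> s01; apply: le_lt_trans lp.
  rewrite !level_pol // lerD2r lerD2r ler_wpM2l ?exprn_ge0 // lerD2r.
  have cosb v : cos (b + v) = - cos v by rewrite cosD cb sb mul0r subr0 mulN1r.
  have -> : cos a = - cos (a - b) by rewrite -cosb; congr cos; ring.
  have -> : a + s * (b - a) = b + (1 - s) * (a - b) by ring.
  rewrite cosb lerN2.
  by apply: cos_shrink => //; lra.
have ray s : 0 <= s <= 1 -> level (pol (r + s * `|M|) b) < 0.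
  move=> /andP[s0 _]; apply: level_ray_neg => //.
  by have : 0 <= s * `|M| by [rewrite mulr_ge0]; lra.
have c1 : continuous (fun s : R => pol r (a + s * (b - a))).
  move=> s; apply: (@continuous_comp _ _ _ (fun s : R => a + s * (b - a)) (pol r)).
    by apply: contD; [exact: cont_cst|apply: contM; [exact: cont_id|exact: cont_cst]].
  exact: continuous_pol_angle.
have c2 : continuous (fun s : R => pol (r + s * `|M|) b).
  move=> s; apply: (@continuous_comp _ _ _ (fun s : R => r + s * `|M|) (pol^~ b)).
    by apply: contD; [exact: cont_cst|apply: contM; [exact: cont_id|exact: cont_cst]].
  exact: continuous_pol_radius.
have := component_path c1 turn; rewrite mul0r addr0 mul1r [a + _]addrC subrK => step1.
have := component_path c2 ray; rewrite mul0r addr0 mul1r => step2.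
have := bnd _ (connected_component_trans step1 step2).
have M0 := ler_norm M.
by rewrite edistC edist_pol ?addr_ge0 ?normr_ge0 //; lra.
Qed.

Lemma interior_regionE : interior_region mx my = [set p | 0 < level p].
Proof.
apply/seteqP; split=> p /=.
  move=> [nc bnd]; have /eqP lp : ~ level p = 0 by rewrite curve_imageE in nc.
  rewrite lt_neqAle eq_sym lp leNgt; apply/negP => ln.
  exact: component_neg_unbounded ln bnd.
move=> lp; split.
  by rewrite curve_imageE /= => l0; move: lp; rewrite l0 ltxx.
exists (rho + 4) => q /(component_pos lp).
have [r [a [r0 ->]]] := plane_pol q => lq.
rewrite edistC edist_pol // leNgt; apply/negP => h.
by move: (lt_trans lq (level_outside a h)); rewrite ltxx.
Qed.

(** Equal radii give [s = t] or [s = - t] modulo 2 pi. In the first case [s - t] is a multiple of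
    the full period, hence 0. In the second, equal angles force [phase t] to be a multiple of pi, so
    [sin t = 0] and the first case applies again. *)
Lemma meander_inj s t : `|s - t| < (pi *+ 2) * mu -> mx s = mx t -> my s = my t -> s = t.
Proof.
move=> st; rewrite /mx /my /= => hx hy.
have p0 : 0 < (pi *+ 2 : R) by rewrite mulrn_wgt0 // pi_gt0.
have rE : rad s = rad t.
  apply/eqP; rewrite -(eqrXn2 (n := 2)) ?ltW ?rad_gt0 //.
  rewrite -[X in X == _]mulr1 -(cos2Dsin2 (phase s / mu)) mulrDr -!exprMn hx hy.
  by rewrite !exprMn -mulrDr cos2Dsin2 mulr1.
have r0 : rad t != 0 by rewrite gt_eqF ?rad_gt0.
move: hx hy; rewrite rE => /(mulfI r0) hc /(mulfI r0) hs.
have cE : cos s = cos t by move: rE; rewrite /rad; lra.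
have [k kE] := cos_sin_eqP hc hs.
have mk : phase s = phase t + (pi *+ 2) * mu * k%:~R.
  move: kE; rewrite -[pi *+ 2 *~ k]mulrzr => /(congr1 (fun x => x * mu)).
  by rewrite (divfK mun0) => ->; rewrite (mulrDl (phase t / mu)) divfK // mulrAC.
have same j : s = t + (pi *+ 2) *~ j -> s = t.
  move=> sE; move: mk st; rewrite {1}sE phase_int => /addrI jE.
  have -> : s - t = (pi *+ 2) *~ j by rewrite sE addrAC subrr add0r.
  rewrite jE normrM [`|_ * mu|]gtr0_norm ?mulr_gt0 //.
  rewrite gtr_pMr ?mulr_gt0 // -intr_norm ltrz1 => k1.
  have k0 : k = 0 by apply/eqP; rewrite -normr_le0 -ltzD1 add0r.
  by rewrite sE jE k0 mulr0 addr0.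
have [j [/same//|sE]] := cos_eqP cE.
have st0 : sin t = 0.
  apply/eqP; apply: contraT => /sin_phase_neq0.
  move: mk; rewrite sE phase_int phaseN -[pi *+ 2 *~ j]mulrzr => mk.
  have -> : phase t = pi *~ (j - m%:Z * k).
    have mE : m%:R = mu by rewrite -[RHS]mulr1 muE.
    rewrite -[RHS]mulrzr intrB intrM /= -[m%:~R]/(m%:R) mE; clear mE.
    by move: mk; rewrite -[pi *+ 2]mulr_natr; move: (j%:~R) (k%:~R) => z z'; lra.
  by rewrite sin_pi_int eqxx.
have ss0 : sin s = 0 by rewrite sE sin_int sinN st0 oppr0.
have [j' /same//] := cos_sin_eqP cE (etrans ss0 (esym st0)).
Qed.

Lemma meander_period : periodic mx ((pi *+ 2) * mu) /\ periodic my ((pi *+ 2) * mu).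
Proof.
have E t : meander (t + (pi *+ 2) * mu) = meander t.
  have LE : (pi *+ 2) * mu = (pi *+ 2) *~ m by rewrite mulrC muE.
  rewrite LE /meander rad_int phase_int -LE /pol.
  have -> : (phase t + (pi *+ 2) * mu) / mu = phase t / mu + (pi *+ 2) *~ 1.
    by rewrite mulrDl mulfK.
  by rewrite cos_int sin_int.
by split=> t; rewrite /mx /my E.
Qed.

End Meander.

(** * Curvature and crowding of the meander *)

Section Estimates.
Variable R : realType.
Implicit Types A W c z E al be x q : R.

Lemma cube_bounds A : -3 <= A <= 5 -> -27 <= A ^+ 3 <= 125.
Proof.
move=> /andP[A1 A2]; have h1 := sqr_ge0 A; apply/andP; split; rewrite -subr_ge0.
  rewrite (_ : _ - _ = (A + 3) * ((A - 3 / 2) ^+ 2 + 27 / 4)); last by field.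
  by rewrite mulr_ge0 //; [lra|rewrite addr_ge0 ?sqr_ge0 //; lra].
rewrite (_ : _ - _ = (5 - A) * ((A + 5 / 2) ^+ 2 + 75 / 4)); last by field.
by rewrite mulr_ge0 //; [lra|rewrite addr_ge0 ?sqr_ge0 //; lra].
Qed.

Lemma sqr_bounds W : 4 / 9 <= W <= 5 / 11 -> 19 / 100 <= W ^+ 2 <= 21 / 100.
Proof. by move=> /andP[w1 w2]; rewrite expr2; apply/andP; split; nra. Qed.

(** The error is split off by (a + E)^2 <= 21/20 a^2 + 21 E^2; then 441/125 is 21/20 times 16 times
    21/100, and 21/25 is 21 times 1/25. *)
Lemma cross_le W c z E : c ^+ 2 = 1 - z -> z <= 1 -> W ^+ 2 <= 21 / 100 ->
  E ^+ 2 <= 1 / 25 -> (4 * W * c * (5 + 8 * z) + E) ^+ 2 <=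
    441 / 125 * (25 + 55 * z - 16 * z ^+ 2 - 64 * z ^+ 3) + 21 / 25.
Proof.
move=> c2 z1 W2 E2; set a := 4 * W * c * (5 + 8 * z).
have a2 : a ^+ 2 = 16 * W ^+ 2 * ((1 - z) * (5 + 8 * z) ^+ 2).
  by rewrite -c2 /a; ring.
have Q0 : 0 <= (1 - z) * (5 + 8 * z) ^+ 2 by rewrite mulr_ge0 ?sqr_ge0 ?subr_ge0.
have QE : (1 - z) * (5 + 8 * z) ^+ 2 = 25 + 55 * z - 16 * z ^+ 2 - 64 * z ^+ 3 by ring.
rewrite -QE; move: Q0 a2 {QE}; move: ((1 - z) * _) => Q Q0 a2.
have aQ : a ^+ 2 <= 84 / 25 * Q by rewrite a2 ler_wpM2r //; lra.
have ae : (a + E) ^+ 2 <= 21 / 20 * a ^+ 2 + 21 * E ^+ 2.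
  rewrite -subr_ge0 (_ : _ - _ = (a - 20 * E) ^+ 2 / 20) ?divr_ge0 ?sqr_ge0 //.
  by field.
apply: le_trans ae _.
by move: aQ E2 {a2}; move: (a ^+ 2) (E ^+ 2) => u v *; lra.
Qed.

Lemma speed_ge W z : 19 / 100 <= W ^+ 2 -> 0 <= z ->
  19 / 4 + 121 / 10 * z ^+ 2 <= 16 * z + W ^+ 2 * (5 - 8 * z) ^+ 2.
Proof.
move=> W2 z0.
have : 19 / 100 * (5 - 8 * z) ^+ 2 <= W ^+ 2 * (5 - 8 * z) ^+ 2.
  by rewrite ler_wpM2r ?sqr_ge0.
have := sqr_ge0 z; rewrite (_ : (5 - 8 * z) ^+ 2 = 25 - 80 * z + 64 * z ^+ 2); last by ring.
by move: (z ^+ 2) (W ^+ 2 * _) => y v; lra.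
Qed.

(* With z = sin^2 t the squared speed is about 5 + 13 z^2 and the square of the
   cross product about 3.2 (1 - z) (5 + 8 z)^2. *)
Lemma turning_bound W c z E : c ^+ 2 = 1 - z -> 0 <= z -> z <= 1 ->
  4 / 9 <= W <= 5 / 11 -> E ^+ 2 <= 1 / 25 ->
  (4 * W * c * (5 + 8 * z) + E) ^+ 2 < (16 * z + W ^+ 2 * (5 - 8 * z) ^+ 2) ^+ 3.
Proof.
move=> c2 z0 z1 /sqr_bounds/andP[W1 W2] E2.
apply: le_lt_trans (cross_le c2 z1 W2 E2) _.
have z2 := sqr_ge0 z; have z3 : 0 <= z ^+ 3 by rewrite exprn_ge0.
have low := speed_ge W1 z0.
have low0 : 0 <= 19 / 4 + 121 / 10 * z ^+ 2 by move: z2; move: (z ^+ 2) => y *; lra.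
apply: (@lt_le_trans _ _ ((19 / 4 + 121 / 10 * z ^+ 2) ^+ 3)); last first.
  by apply: lerXn2r; rewrite ?nnegrE ?(le_trans low0 low).
have -> : (19 / 4 + 121 / 10 * z ^+ 2) ^+ 3 =
    (19 / 4) ^+ 3 + 3 * (19 / 4) ^+ 2 * (121 / 10) * z ^+ 2
    + 3 * (19 / 4) * (121 / 10) ^+ 2 * (z ^+ 2) ^+ 2 + (121 / 10) ^+ 3 * (z ^+ 2) ^+ 3.
  by ring.
have y2 : 0 <= 3 * (19 / 4) * (121 / 10) ^+ 2 * (z ^+ 2) ^+ 2.
  by rewrite mulr_ge0 ?sqr_ge0 // mulr_ge0 ?sqr_ge0 //; lra.
have y3 : 0 <= (121 / 10) ^+ 3 * (z ^+ 2) ^+ 3.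
  by rewrite mulr_ge0 ?exprn_ge0 //; lra.
(* After [z ^+ 3] is dropped, what remains is about 874 z^2 - 194 z plus a constant, with its
   minimum near 1/9; the tangent there makes the claim linear. *)
have := sqr_ge0 (z - 1 / 9).
rewrite (_ : (z - 1 / 9) ^+ 2 = z ^+ 2 - 2 / 9 * z + 1 / 81); last by field.
have low3 : 107 <= (19 / 4) ^+ 3 :> R by rewrite !exprS expr0; lra.
have lin : 818 * z ^+ 2 <= 3 * (19 / 4) ^+ 2 * (121 / 10) * z ^+ 2.
  by rewrite ler_wpM2r // expr2; lra.
suff key k3 k1 k2 k4 y v : 107 <= k3 -> 818 * y <= k1 -> 0 <= k2 -> 0 <= k4 ->
    0 <= v -> 0 <= y - 2 / 9 * z + 1 / 81 ->
    441 / 125 * (25 + 55 * z - 16 * y - 64 * v) + 21 / 25 < k3 + k1 + k2 + k4.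
  exact: key.
by move=> {z2 z3 low low0 y2 y3 low3 lin} *; lra.
Qed.

(** The part of the cross product due to winding around the circle: the numerator is below 200 in
    absolute value, so [mu >= 1000] leaves at most 1/5. *)
Lemma error_bound (v z mu : R) : 0 <= v <= 21 / 100 -> 0 <= z <= 1 -> 100 * 10 <= mu ->
  ((32 * z * (5 - 8 * z) + v * (5 - 8 * z) ^+ 3) / mu) ^+ 2 <= 1 / 25.
Proof.
move=> /andP[v0 v1] /andP[z0 z1] mu_ge; have mu0 : 0 < mu by lra.
rewrite (_ : 1 / 25 = (1 / 5) ^+ 2); last by field.
rewrite -norm_le_sqr ?divr_ge0 // ler_norml ler_pdivrMr // ler_pdivlMr //.
have /cube_bounds/andP[A1 A2] : -3 <= 5 - 8 * z <= 5 by lra.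
move: A1 A2; move: ((5 - 8 * z) ^+ 3) => B B1 B2.
have C1 : v * -27 <= v * B by rewrite ler_wpM2l.
have C2 : v * B <= v * 125 by rewrite ler_wpM2l.
have D1 : 32 * z * -3 <= 32 * z * (5 - 8 * z) by rewrite ler_wpM2l ?mulr_ge0 //; lra.
have D2 : 32 * z * (5 - 8 * z) <= 32 * z * 5 by rewrite ler_wpM2l ?mulr_ge0 //; lra.
move: C1 C2 D1 D2; move: (v * B) (32 * z * (5 - 8 * z)) => p q *.
by apply/andP; split; lra.
Qed.

(** The normal at a neck is nearly angular: [al2 / be2] is at most 1.89 / 15.84, below 0.12. *)
Lemma transverse_bound (s2 v al2 be2 : R) : 99 / 100 <= s2 -> v <= 21 / 100 * 9 ->
  0 <= al2 -> 0 <= be2 -> 16 * (s2 * al2) = v * be2 -> al2 + be2 = 1 -> (47 / 50) ^+ 2 <= be2.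
Proof.
move=> s2b vb al0 be0 E ab.
have h2 : v * be2 <= 21 / 100 * 9 * be2 by rewrite ler_wpM2r.
have h3 : 99 / 100 * al2 <= s2 * al2 by rewrite ler_wpM2r.
rewrite expr2.
by move: E h2 h3 {s2b vb}; move: (s2 * al2) (v * be2) => p q *; lra.
Qed.

(** Expanding with [al ^+ 2 + be ^+ 2 = 1] and the bounds leaves q^2 - 1.88 q + 0.1025 < 0, true
    between about 0.06 and 1.82. *)
Lemma nearby_center al be x q : al ^+ 2 + be ^+ 2 = 1 -> (47 / 50) ^+ 2 <= be ^+ 2 ->
  `|x| <= 1 / 20 -> 3 / 5 <= q <= 181 / 100 ->
  (al - x) ^+ 2 + (be ^+ 2 - 2 * (`|be| * q) + q ^+ 2) < 1.
Proof.
move=> ab be2 xb /andP[q1 q2].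
have bb : 47 / 50 <= `|be|.
  rewrite -(@ler_pXn2r _ 2) ?nnegrE ?normr_ge0 //.
  by rewrite real_normK ?num_real.
have al1 : `|al| <= 1 by rewrite norm_le_sqr // expr1n -ab lerDl sqr_ge0.
have ax : `|al * x| <= 1 / 20 by rewrite normrM -[leRHS]mul1r ler_pM.
have xx : x ^+ 2 <= (1 / 20) ^+ 2 by rewrite -norm_le_sqr ?divr_ge0.
have bq : 47 / 50 * q <= `|be| * q by rewrite ler_wpM2r //; lra.
have qq : 0 <= (q - 3 / 5) * (181 / 100 - q) by rewrite mulr_ge0 ?subr_ge0.
rewrite (_ : (q - _) * _ = 241 / 100 * q - 543 / 500 - q ^+ 2) in qq; last by field.
rewrite (_ : (al - x) ^+ 2 = al ^+ 2 - 2 * (al * x) + x ^+ 2); last by ring.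
move: ax; rewrite ler_norml => /andP[ax _]; move: xx ab.
rewrite (_ : (1 / 20) ^+ 2 = 1 / 400 :> R); last by field.
move: ax qq bq {be2 bb al1 xb}.
move: (al * x) (x ^+ 2) (al ^+ 2) (be ^+ 2) (q ^+ 2) (`|be| * q).
by move=> *; lra.
Qed.

(** Distance is computed in the orthonormal radial and angular frame at a curve point; [k] and [h]
    are cosine and sine of the further rotation to the neighbouring strand. *)
Lemma frame_distance (a : R * R) (C S r r' k h : R) : C ^+ 2 + S ^+ 2 = 1 ->
  sqd a (r' * (C * k - S * h), r' * (S * k + C * h)) =
  ((a.1 - r * C) * C + (a.2 - r * S) * S - (r' * k - r)) ^+ 2 +
  ((a.2 - r * S) * C - (a.1 - r * C) * S - r' * h) ^+ 2.
Proof.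
move=> CS; case: a => a1 a2; rewrite /sqd /=.
pose d1 := a1 - r' * (C * k - S * h); pose d2 := a2 - r' * (S * k + C * h).
have e1 : (a1 - r * C) * C + (a2 - r * S) * S - (r' * k - r) =
    d1 * C + d2 * S + (C ^+ 2 + S ^+ 2 - 1) * (r' * k - r) by rewrite /d1 /d2; ring.
have e2 : (a2 - r * S) * C - (a1 - r * C) * S - r' * h =
    d2 * C - d1 * S + (C ^+ 2 + S ^+ 2 - 1) * (r' * h) by rewrite /d1 /d2; ring.
rewrite e1 e2 CS subrr !mul0r !addr0.
transitivity ((d1 ^+ 2 + d2 ^+ 2) * (C ^+ 2 + S ^+ 2)); first by rewrite CS mulr1.
by ring.
Qed.

(** Passing from [t] to [t + pi] or [t - pi] flips [cos t], whence [r'], and turns by [pi / mu]. The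
    radial offset is essentially [8 * c], so the width 1/200 keeps it near 1/25; the range of
    [r' * sin (pi / mu)] comes from 3 < pi < 4. *)
Lemma neighbour_offset (mu c : R) : 100 * 10 <= mu -> - (1 / 200) < c < 1 / 200 ->
  let r' := 9 / 20 * mu - 4 * c in
  3 / 5 <= r' * sin (pi / mu) <= 181 / 100 /\
  `|r' * cos (pi / mu) - (9 / 20 * mu + 4 * c)| <= 1 / 20.
Proof.
move=> mu_ge cb r'; have mu_gt0 : 0 < mu by lra.
have p3 := @pi_gt3 R; have p4 : pi < 4 :> R by have := pihalf_lt2 R; lra.
have [De DeE] : exists De, De = pi / mu by eexists.
have De0 : 0 < De by rewrite DeE divr_gt0 ?pi_gt0.
have De1 : De <= 1 / 250 by rewrite DeE ler_pdivrMr //; lra.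
have muDe : mu * De = pi by rewrite DeE mulrC divfK // gt_eqF.
have [r1 r2] : 22 / 50 * mu <= r' /\ r' <= (9 / 20 + 1 / 500) * mu.
  by case/andP: cb => ? ?; rewrite /r'; split; lra.
have r'0 : 0 <= r' by apply: le_trans r1; rewrite mulr_ge0 ?divr_ge0 // ltW.
rewrite -DeE; split.
  have h1 : De / 2 <= sin De by rewrite sin_ge_half // ltW //=; lra.
  have h2 : sin De <= De by rewrite sin_le // ltW.
  have De20 : 0 <= De / 2 by rewrite divr_ge0 // ltW.
  have q1 : 22 / 50 * mu * (De / 2) <= r' * sin De.
    by apply: ler_pM => //; rewrite mulr_ge0 ?divr_ge0 // ltW.
  have q2 : r' * sin De <= (9 / 20 + 1 / 500) * mu * De.
    by apply: ler_pM => //; apply: le_trans h1.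
  move: q1 q2; rewrite mulrA -!(mulrA _ mu De) muDe; move: (r' * sin De) => q q1 q2.
  by apply/andP; split; lra.
have k1 : 0 <= 1 - cos De by rewrite subr_ge0 cos_le1.
have k2 : 1 - cos De <= De ^+ 2 / 2 by have := cos_ge_parabola (ltW De0); lra.
have e1 : r' * (1 - cos De) <= (9 / 20 + 1 / 500) * mu * (De ^+ 2 / 2) by exact: ler_pM.
have e2 : 0 <= r' * (1 - cos De) by rewrite mulr_ge0.
have e3 : mu * De ^+ 2 <= 4 * (1 / 250).
  by rewrite expr2 mulrA muDe; apply: ler_pM; rewrite // ?pi_ge0 ?ltW.
rewrite (_ : r' * _ - _ = - (r' * (1 - cos De)) - 8 * c); last by rewrite /r'; ring.
move: e1 e2; rewrite mulrA -(mulrA _ mu); move: e3 {k1 k2 r1 r2 r'0}.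
move: (r' * (1 - cos De)) (mu * De ^+ 2) => p y *.
by case/andP: cb => ? ?; rewrite ler_norml; apply/andP; split; lra.
Qed.

End Estimates.

(** * Derivatives of the meander in the moving polar frame *)

Section MeanderCalculus.
Variables (R : realType) (mu : R).
Local Notation P := (R * R)%type.
Hypothesis mu_ge : 100 * 10 <= mu.
Local Notation rho := (9 / 20 * mu).
Local Notation mx := (mx mu).
Local Notation my := (my mu).
Local Notation rad := (rad mu).
Local Notation meander := (meander mu).

Let mun0 : mu != 0. Proof. by rewrite gt_eqF //; have := mu_ge; lra. Qed.

Lemma is_derive_comp1 (f g : R -> R) (t df dg : R) : is_derive (t : R) 1 f df ->
  is_derive (f t) 1 g dg -> is_derive (t : R) 1 (fun s => g (f s)) (dg * df).
Proof.
move=> [fd fE] [gd gE]; have cd : derivable (g \o f) t 1.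
  by apply/derivable1_diffP/differentiable_comp; apply/derivable1_diffP.
split; first exact: cd.
by have := derive1_comp fd gd; rewrite !derive1E fE gE => <-.
Qed.

Definition dphase (t : R) : R := 8 * cos t ^+ 2 - 3.

Lemma is_derive_phase (t : R) : is_derive t 1 (@phase R) (dphase t).
Proof.
have -> : @phase R = (fun s => s + 4 * (sin s * cos s)) by [].
apply: is_derive_eq; rewrite /dphase /GRing.scale /=.
have := sin2cos2 t; rewrite !expr2 => h.
have -> : 8 * (cos t * cos t) - 3 = 1 + 4 * (cos t * cos t - (1 - cos t * cos t)) by ring.
by rewrite -h; ring.
Qed.

Lemma is_derive_angle (t : R) : is_derive t 1 (fun s : R => phase s / mu) (dphase t / mu).
Proof.
have d := is_derive_phase t.
by apply: is_derive_eq; rewrite /GRing.scale /=; ring.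
Qed.

Lemma is_derive_cos_angle (t : R) : is_derive t 1 (fun s : R => cos (phase s / mu))
  (- sin (phase t / mu) * (dphase t / mu)).
Proof. exact: is_derive_comp1 (is_derive_angle t) _. Qed.

Lemma is_derive_sin_angle (t : R) : is_derive t 1 (fun s : R => sin (phase s / mu))
  (cos (phase t / mu) * (dphase t / mu)).
Proof. exact: is_derive_comp1 (is_derive_angle t) _. Qed.

Lemma is_derive_rad (t : R) : is_derive t 1 rad (- 4 * sin t).
Proof.
have -> : rad = (fun s : R => rho + 4 * cos s) by [].
by apply: is_derive_eq; rewrite /GRing.scale /=; ring.
Qed.

Lemma is_derive_dphase (t : R) : is_derive t 1 dphase (- 16 * (cos t * sin t)).
Proof.
have -> : dphase = (fun s : R => 8 * (cos s * cos s) - 3).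
  by apply/funext => s; rewrite /dphase expr2.
by apply: is_derive_eq; rewrite /GRing.scale /=; ring.
Qed.

Definition mx1 (t : R) : R := - 4 * sin t * cos (phase t / mu)
  - rad t * (dphase t / mu) * sin (phase t / mu).
Definition my1 (t : R) : R := - 4 * sin t * sin (phase t / mu)
  + rad t * (dphase t / mu) * cos (phase t / mu).
(** With [angular2], the polar components of acceleration: r'' - r theta'^2 and 2 r' theta' + r
    theta''. *)
Definition radial2 (t : R) : R := - 4 * cos t - rad t * (dphase t / mu) ^+ 2.
Definition angular2 (t : R) : R :=
  2 * (- 4 * sin t) * (dphase t / mu) + rad t * (- 16 * (cos t * sin t) / mu).
Definition mx2 (t : R) : R := radial2 t * cos (phase t / mu) - angular2 t * sin (phase t / mu).
Definition my2 (t : R) : R := radial2 t * sin (phase t / mu) + angular2 t * cos (phase t / mu).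

Lemma is_derive_mx (t : R) : is_derive t 1 mx (mx1 t).
Proof.
have -> : mx = (fun s : R => rad s * cos (phase s / mu)) by [].
have dr := is_derive_rad t; have dc := is_derive_cos_angle t.
by apply: is_derive_eq; rewrite /mx1 /GRing.scale /=; ring.
Qed.

Lemma is_derive_my (t : R) : is_derive t 1 my (my1 t).
Proof.
have -> : my = (fun s : R => rad s * sin (phase s / mu)) by [].
have dr := is_derive_rad t; have ds := is_derive_sin_angle t.
by apply: is_derive_eq; rewrite /my1 /GRing.scale /=; ring.
Qed.

Lemma is_derive_mx1 (t : R) : is_derive t 1 mx1 (mx2 t).
Proof.
have dr := is_derive_rad t; have ds := is_derive_sin_angle t.
have dc := is_derive_cos_angle t; have dp := is_derive_dphase t.
by apply: is_derive_eq; rewrite /mx2 /radial2 /angular2 /GRing.scale /=; ring.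
Qed.

Lemma is_derive_my1 (t : R) : is_derive t 1 my1 (my2 t).
Proof.
have dr := is_derive_rad t; have ds := is_derive_sin_angle t.
have dc := is_derive_cos_angle t; have dp := is_derive_dphase t.
by apply: is_derive_eq; rewrite /my2 /radial2 /angular2 /GRing.scale /=; ring.
Qed.

Lemma continuous_second_derivatives : continuous mx2 /\ continuous my2.
Proof.
have cC := is_derive_continuous is_derive_cos_angle.
have cS := is_derive_continuous is_derive_sin_angle.
have cr := is_derive_continuous is_derive_rad.
have cp : continuous (fun t => dphase t / mu).
  by apply: contM; [exact: is_derive_continuous is_derive_dphase|exact: cont_cst].
have cc := @continuous_cos R; have cs := @continuous_sin R.
have c1 : continuous radial2.
  apply: contB; first by apply: contM => //; exact: cont_cst.
  by apply: contM => //; exact: contX.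
have c2 : continuous angular2.
  apply: contD; first apply: contM => //; first apply: contM.
  - exact: cont_cst.
  - by apply: contM => //; exact: cont_cst.
  - apply: contM => //; apply: contM; last exact: cont_cst.
    by apply: contM; [exact: cont_cst|exact: contM].
by split; [apply: contB|apply: contD]; exact: contM.
Qed.

Let w t := rad t / mu.

Let mu_gt0 : 0 < mu. Proof. by have := mu_ge; lra. Qed.

Let w_bound t : 4 / 9 <= w t <= 5 / 11.
Proof.
rewrite /w /rad ler_pdivlMr // ler_pdivrMr //.
have := cos_geN1 t; have := cos_le1 t; have := mu_ge.
by move: (cos t) => c *; apply/andP; split; lra.
Qed.

Lemma meander_speed t : mx1 t ^+ 2 + my1 t ^+ 2 = 16 * sin t ^+ 2 + w t ^+ 2 * dphase t ^+ 2.
Proof.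
transitivity ((16 * sin t ^+ 2 + w t ^+ 2 * dphase t ^+ 2) *
  (cos (phase t / mu) ^+ 2 + sin (phase t / mu) ^+ 2)); last by rewrite cos2Dsin2 mulr1.
by rewrite /mx1 /my1 /w; ring.
Qed.

(** The first summand is the cross product for a straight strip with scale [w t]; the second is the
    correction of order [1 / mu]. *)
Lemma meander_cross t : mx1 t * my2 t - my1 t * mx2 t =
  4 * w t * cos t * (16 * sin t ^+ 2 + dphase t) +
  (32 * sin t ^+ 2 * dphase t + w t ^+ 2 * dphase t ^+ 3) / mu.
Proof.
transitivity ((4 * w t * cos t * (16 * sin t ^+ 2 + dphase t) +
  (32 * sin t ^+ 2 * dphase t + w t ^+ 2 * dphase t ^+ 3) / mu) *
  (cos (phase t / mu) ^+ 2 + sin (phase t / mu) ^+ 2)); last by rewrite cos2Dsin2 mulr1.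
by rewrite /mx1 /my1 /mx2 /my2 /radial2 /angular2 /w; ring.
Qed.

Lemma meander_curvature t :
  (mx1 t * my2 t - my1 t * mx2 t) ^+ 2 < (mx1 t ^+ 2 + my1 t ^+ 2) ^+ 3.
Proof.
rewrite meander_cross meander_speed.
have [z zE] : exists z, z = sin t ^+ 2 by eexists.
have z0 : 0 <= z by rewrite zE sqr_ge0.
have c2 : cos t ^+ 2 = 1 - z by rewrite zE cos2sin2.
have z1 : z <= 1 by have := sqr_ge0 (cos t); lra.
have AE : dphase t = 5 - 8 * z by rewrite /dphase c2; ring.
rewrite -zE AE (_ : 16 * z + (5 - 8 * z) = 5 + 8 * z); last by ring.
have wb := w_bound t; apply: turning_bound => //.
have /andP[W1 W2] := sqr_bounds wb.
by apply: error_bound => //; rewrite ?z0 ?W2 ?sqr_ge0.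
Qed.

(* A point at distance 1 from meander t with no nearer point on the same strand is
   meander t + al * (radial) + be * (angular) with |be| close to 1, and the strand at
   t + pi or t - pi lies at angular distance less than 2 |be| on its side. *)
Lemma meander_crowded t (a : P) : `|cos t| < 1 / 200 -> edist a (meander t) <= 1 ->
  exists2 t', `|cos t'| < 1 / 200 & edist a (meander t') < 1.
Proof.
move=> ct; rewrite le_eqVlt => /orP[/eqP a1|]; last by exists t.
have {}a1 : sqd a (meander t) = 1 by rewrite -edist_sqr a1 expr1n.
have near_t : exists2 e : R, 0 < e & forall s, `|s - t| < e -> `|cos s| < 1 / 200.
  have h : nbhs (cos t) [set x : R | `|x| < 1 / 200].
    apply/nbhs_ballP; exists (1 / 200 - `|cos t|); first by rewrite /= subr_gt0.
    move=> x; rewrite /ball /= => xt.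
    by have := ler_normB (cos t) (cos t - x); rewrite subKr; lra.
  have /nbhs_ballP[e /= e0 he] := @continuous_cos R t _ h.
  by exists e => // s st; apply: he; rewrite /ball /= distrC.
have [e e0 et] := near_t.
pose f s := (a.1 - mx s) ^+ 2 + (a.2 - my s) ^+ 2.
pose df s := - 2 * ((a.1 - mx s) * mx1 s + (a.2 - my s) * my1 s).
have fD (s : R) : is_derive s 1 f (df s).
  have dx := is_derive_mx s; have dy := is_derive_my s.
  by apply: is_derive_eq; rewrite /df /GRing.scale /=; ring.
have [D0|Dn0] := eqVneq (df t) 0; last first.
  have [s st fs] := decrease_near fD Dn0 e0.
  exists s; first exact: et.
  by rewrite edist_lt1; apply: lt_le_trans fs _; rewrite -a1.
set c := cos t in ct.
pose C := cos (phase t / mu); pose S := sin (phase t / mu).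
have CS : C ^+ 2 + S ^+ 2 = 1 by exact: cos2Dsin2.
pose u1 := a.1 - rad t * C; pose u2 := a.2 - rad t * S.
pose al := u1 * C + u2 * S; pose be := u2 * C - u1 * S.
have alE : al ^+ 2 + be ^+ 2 = 1.
  transitivity ((u1 ^+ 2 + u2 ^+ 2) * (C ^+ 2 + S ^+ 2)); first by rewrite /al /be; ring.
  by rewrite CS mulr1 -a1.
(* Vanishing of [df t] in frame coordinates: the offset of [a] is normal to the strand. *)
have ort : 4 * sin t * al = w t * dphase t * be.
  have : df t = 2 * (4 * sin t * al - w t * dphase t * be).
    by rewrite /df /mx1 /my1 -/C -/S -[a.1 - mx t]/u1 -[a.2 - my t]/u2 /w /al /be; ring.
  by rewrite D0 => /esym/eqP; rewrite mulf_eq0 pnatr_eq0 /= subr_eq0 => /eqP.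
have c2 : c ^+ 2 <= 1 / 100.
  apply: (@le_trans _ _ ((1 / 10) ^+ 2)); last by rewrite expr2; lra.
  by rewrite -norm_le_sqr ?divr_ge0 //; lra.
have s2 : 99 / 100 <= sin t ^+ 2 by rewrite sin2cos2 -/c; lra.
have /andP[_ W2] := sqr_bounds (w_bound t).
have dp2 : dphase t ^+ 2 <= 9.
  rewrite -[9](_ : 3 ^+ 2 = 9); last by ring.
  by rewrite -norm_le_sqr // ler_norml /dphase -/c; have := sqr_ge0 c; lra.
have be2 : (47 / 50) ^+ 2 <= be ^+ 2.
  have v1 : w t ^+ 2 * dphase t ^+ 2 <= 21 / 100 * 9 by rewrite ler_pM ?sqr_ge0.
  have E : 16 * (sin t ^+ 2 * al ^+ 2) = w t ^+ 2 * dphase t ^+ 2 * be ^+ 2.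
    rewrite (_ : 16 * _ = (4 * sin t * al) ^+ 2); last by ring.
    by rewrite ort (exprMn 2 (w t * dphase t)) (exprMn 2 (w t)).
  exact: transverse_bound s2 v1 (sqr_ge0 _) (sqr_ge0 _) E alE.
pose k := cos (pi / mu); pose h0 := sin (pi / mu); pose r' := rho - 4 * c.
have cb : - (1 / 200) < c < 1 / 200 by rewrite -ltr_norml.
have [qb w1b] := neighbour_offset mu_ge cb.
(* [h] will be [h0] or [- h0], with the sign of [be], so both neighbours are treated together. *)
have main h : be * h = `|be| * h0 -> h ^+ 2 = h0 ^+ 2 ->
    (al - (r' * k - rad t)) ^+ 2 + (be - r' * h) ^+ 2 < 1.
  move=> bh hh.
  have -> : (be - r' * h) ^+ 2 = be ^+ 2 - 2 * (`|be| * (r' * h0)) + (r' * h0) ^+ 2.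
    transitivity (be ^+ 2 - 2 * r' * (be * h) + r' ^+ 2 * h ^+ 2); first by ring.
    by rewrite bh hh; ring.
  exact: nearby_center.
have shift t' h : cos t' = - c -> be * h = `|be| * h0 -> h ^+ 2 = h0 ^+ 2 ->
    cos (phase t' / mu) = C * k - S * h -> sin (phase t' / mu) = S * k + C * h ->
    exists2 t', `|cos t'| < 1 / 200 & edist a (meander t') < 1.
  move=> ct' bh hh Ct' St'; exists t'; first by rewrite ct' normrN.
  rewrite edist_lt1 /meander /pol Ct' St' /rad ct'.
  have := main h bh hh; rewrite /al /be /u1 /u2 -(frame_distance _ _ _ _ _ CS).
  by rewrite /r' mulrN.
have angle_p : phase (t + pi) / mu = phase t / mu + pi / mu.
  by rewrite phaseDpi (mulrDl (phase t)).
have angle_m : phase (t - pi) / mu = phase t / mu - pi / mu.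
  by have := phaseDpi (t - pi); rewrite subrK => ->; rewrite (mulrDl (phase _)) addrK.
have [b0|b0] := leP 0 be.
  apply: (shift (t + pi) h0) => //; first exact: cosDpi.
  - by rewrite (ger0_norm b0).
  - by rewrite angle_p cosD.
  - by rewrite angle_p sinD.
apply: (shift (t - pi) (- h0)).
- by have := cosDpi (t - pi); rewrite subrK /c => ->; rewrite opprK.
- by rewrite (ltr0_norm b0) mulrN mulNr.
- by rewrite sqrrN.
- by rewrite angle_m cosB mulrN opprK.
- by rewrite angle_m sinB mulrN.
Qed.

End MeanderCalculus.

(** * From explicit derivatives to [derive1], and assembly of the result *)

Section DerivedCurve.
Variables (R : realType) (x y x1 y1 x2 y2 : R -> R).
Hypothesis xD : forall t : R, is_derive t 1 x (x1 t).
Hypothesis yD : forall t : R, is_derive t 1 y (y1 t).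
Hypothesis x1D : forall t : R, is_derive t 1 x1 (x2 t).
Hypothesis y1D : forall t : R, is_derive t 1 y1 (y2 t).
Hypothesis x2C : continuous x2.
Hypothesis y2C : continuous y2.
Hypothesis curv : forall t,
  (x1 t * y2 t - y1 t * x2 t) ^+ 2 < (x1 t ^+ 2 + y1 t ^+ 2) ^+ 3.

Lemma derive1_fun (f df : R -> R) : (forall t : R, is_derive t 1 f (df t)) -> derive1 f = df.
Proof. by move=> fD; apply/funext => t; rewrite derive1E; apply: derive_val. Qed.

Lemma regular_jordan_loop L : 0 < L -> periodic x L -> periodic y L ->
  (forall s t, `|s - t| < L -> x s = x t -> y s = y t -> s = t) ->
  C2_regular_jordan_loop x y L.
Proof.
move=> L0 xper yper inj.
have ex := derive1_fun xD; have ey := derive1_fun yD.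
have ex1 := derive1_fun x1D; have ey1 := derive1_fun y1D.
split.
- by split=> // t; split.
- move=> s t /andP[s0 sL] /andP[t0 tL] [xE yE]; apply: inj => //.
  by rewrite ltr_distl; apply/andP; split; lra.
- by move=> t; rewrite ex ey; split; [case: (xD t)|case: (yD t)|case: (x1D t)|case: (y1D t)].
- by rewrite ex ey ex1 ey1.
- by move=> t; rewrite ex ey gt_eqF // (speed_gt0 curv).
Qed.

Lemma curvature_lt1 t : -1 < curvature x y t < 1.
Proof.
rewrite /curvature !(derive1_fun xD) !(derive1_fun yD) !(derive1_fun x1D) !(derive1_fun y1D).
have N0 := speed_gt0 curv t.
have d0 : 0 < Num.sqrt (x1 t ^+ 2 + y1 t ^+ 2) ^+ 3 by rewrite exprn_gt0 // sqrtr_gt0.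
rewrite -ltr_norml normrM normfV (gtr0_norm d0) ltr_pdivrMr // mul1r norm_lt_sqr //.
by rewrite exprAC sqr_sqrtr ?curv // ltW.
Qed.

End DerivedCurve.

Lemma meander_not_drawable (R : realType) (m : nat) (mu : R) :
  (forall a, mu * a = a *+ m) -> 100 * 10 <= mu ->
  ~ drawable [set p | 0 < level m mu p] /\ ~ cdrawable [set p | 0 < level m mu p].
Proof.
move=> muE mu_ge.
apply: (@crowded_not_drawable _ [set meander mu t | t in [set t | `|cos t| < 1 / 200]]).
- exists (meander mu (pi / 2)), (pi / 2) => //=.
  by rewrite cos_pihalf normr0 divr_gt0.
- move=> _ a [t /= ct <-] /(meander_crowded mu_ge ct)[t' ct' at'].
  by exists (meander mu t') => //; exists t'.
- move=> _ e [t /= ct <-] e0; split.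
    have st : sin t != 0.
      apply: contraTneq ct => /sin0cos1 ->.
      by rewrite -leNgt ler_pdivrMr // mul1r ler1n.
    by have [q qe lq] := level_pos_near muE mu_ge st e0; exists q.
  have [q qe lq] := level_neg_near muE mu_ge t e0; exists q => //=.
  by apply/negP; rewrite -leNgt ltW.
Qed.

Theorem theorem1p2 (R : realType) :
  exists (x y : R -> R) (L : R),
    [/\ C2_regular_jordan_loop x y L,
        (forall t, -1 < curvature x y t < 1),
        ~ drawable (interior_region x y),
        ~ cdrawable (interior_region x y) /\
        locally_drawable (interior_region x y) &
        locally_cdrawable (interior_region x y)].
Proof.
have [m [mu [muE mu_ge]]] : exists (m : nat) (mu : R),
    (forall a, mu * a = a *+ m) /\ 100 * 10 <= mu.
  by exists (100 * 10)%N, (100 * 10)%:R; split=> [a|]; [rewrite mulr_natl|rewrite natrM].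
have L0 : 0 < (pi *+ 2) * mu by rewrite mulr_gt0 //; [rewrite mulrn_wgt0 ?pi_gt0|lra].
have [xC yC] := continuous_second_derivatives mu.
have [xper yper] := meander_period muE mu_ge.
have inj := meander_inj muE mu_ge.
have xD := is_derive_mx mu; have yD := is_derive_my mu.
have x1D := is_derive_mx1 mu; have y1D := is_derive_my1 mu.
have curv := meander_curvature mu_ge.
have FC : continuous (level m mu) by exact: continuous_level.
have F0 p : level m mu p = 0 <-> exists t, p = (mx mu t, my mu t).
  by rewrite (level_eq0P muE mu_ge); split=> -[t ->]; exists t.
have Fneg t e : 0 < e -> exists2 q, edist q (mx mu t, my mu t) < e & level m mu q < 0.
  exact: level_neg_near muE mu_ge t e.
have [nd ncd] := meander_not_drawable muE mu_ge.
exists (mx mu), (my mu), ((pi *+ 2) * mu); rewrite (interior_regionE muE mu_ge); split=> //.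
- exact (@regular_jordan_loop R _ _ _ _ _ _ xD yD x1D y1D xC yC curv _ L0 xper yper inj).
- exact: curvature_lt1 xD yD x1D y1D curv.
- split=> //.
  exact (@loop_locally_drawable R _ _ _ _ _ _ _ _ xD yD x1D y1D xC yC
    curv L0 xper yper inj FC F0).
- exact (@loop_locally_cdrawable R _ _ _ _ _ _ _ _ xD yD x1D y1D xC yC
    curv L0 xper yper inj FC F0 Fneg).
Qed.
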